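(* Let $f\in R[x^{\pm1}]$ be a Laurent polynomial with $v(f)=0$. Then an optimal decomposition of $f$ exists and can be computed effectively.
   Context: $R_1$ is a complete discrete valuation ring with quotient field $K_1$ of characteristic $0$ and residue field of characteristic $2$; $K$ is an algebraic closure of $K_1$; $R$ is the integral closure of $R_1$ in $K$, a valuation ring with $\mathbb Q$-valued valuation $v$ normalized by $v(2)=1$. For a Laurent polynomial $f=\sum_i a_ix^i\in K[x^{\pm1}]$ put $v(f):=\inf\{v(a_i)\mid i\in\mathbb Z\}$. For $f\in R[x^{\pm1}]$ with $v(f)=0$ put $$w(f):=\sup\{v(f-h^2)\mid h\in R[x^{\pm1}]\}\in\mathbb R\cup\{\infty\}.$$ A decomposition $f=h^2+g$ with $g,h\in R[x^{\pm1}]$ is called optimal if $v(g)=w(f)$ or $v(g)>2$. *)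

(* Defs.v *)
From HB Require Import structures.
From mathcomp Require Import all_boot all_order all_algebra.
From mathcomp Require Import finmap.
From mathcomp Require Import boolp classical_sets reals constructive_ereal ereal.

Set Implicit Arguments.
Unset Strict Implicit.
Unset Printing Implicit Defensive.

Import Order.TTheory GRing.Theory Num.Theory.

Local Open Scope classical_set_scope.
Local Open Scope ring_scope.

(* Laurent polynomials over K; the coefficient of x^i in f is f i. *)
Definition laurent (K : nzRingType) := {fsfun int -> K with 0}.

Section LaurentRing.
Variable K : comNzRingType.
Implicit Types f g h : laurent K.

HB.instance Definition _ := Choice.on (laurent K).

Let supp f : {fset int} := finsupp f.

Definition lzero : laurent K := [fsfun].
Definition lone : laurent K := [fsfun i in [fset (0 : int)%R]%fset => 1].
Definition lopp f : laurent K := [fsfun i in supp f => - f i].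
Definition ladd f g : laurent K :=
  [fsfun i in (supp f `|` supp g)%fset => f i + g i].
Definition lmul f g : laurent K :=
  [fsfun k in [fset (i + j)%R | i in supp f, j in supp g]%fset =>
     \sum_(i <- supp f) f i * g (k - i)].

Lemma lzeroE i : lzero i = 0. Proof. by rewrite fsfun_dflt // finsupp0. Qed.

Lemma loneE i : lone i = (i == 0)%:R.
Proof. by rewrite fsfunE inE; case: eqP. Qed.

Lemma loppE f i : lopp f i = - f i.
Proof. by rewrite fsfunE; case: finsuppP; rewrite ?oppr0. Qed.

Lemma laddE f g i : ladd f g i = f i + g i.
Proof.
by rewrite fsfunE inE; case: (finsuppP f); case: (finsuppP g); rewrite ?addr0.
Qed.

Lemma lmulE f g k : lmul f g k = \sum_(i <- supp f) f i * g (k - i).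
Proof.
rewrite fsfunE; case: ifPn => // nk; rewrite big_seq big1 // => i fi.
have [gi|/fsfun_dflt->] := boolP (k - i \in supp g); last by rewrite mulr0.
case/negP: nk; apply/imfset2P; exists i => //; exists (k - i) => //.
by rewrite addrC subrK.
Qed.

Lemma lmulEw (D : {fset int}) f g k : (supp f `<=` D)%fset ->
  lmul f g k = \sum_(i <- D) f i * g (k - i).
Proof.
move=> sD; rewrite lmulE (big_fset_incl _ sD) // => i _ /fsfun_dflt->.
by rewrite mul0r.
Qed.

Lemma lmulEr (D : {fset int}) f g k :
  (forall j, j \in supp g -> k - j \in D) ->
  \sum_(i <- D) f i * g (k - i) = \sum_(j <- supp g) f (k - j) * g j.
Proof.
move=> gD; have inj : injective (fun j : int => k - j).
  by move=> i j /addrI/oppr_inj.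
rewrite -(@big_fset_incl _ _ _ _ [fset (k - j)%R | j in supp g]%fset).
- rewrite big_imfset /=; last by move=> i j _ _; apply: inj.
  by apply: eq_bigr => j _; rewrite subKr.
- by apply/fsubsetP => _ /imfsetP[j jg ->]; apply: gD.
- move=> i _ ni; rewrite [g _]fsfun_dflt ?mulr0 //; apply: contra ni => gi.
  by apply/imfsetP; exists (k - i); rewrite // subKr.
Qed.

Lemma laddA : associative ladd.
Proof. by move=> f g h; apply/fsfunP=> i; rewrite !laddE addrA. Qed.

Lemma laddC : commutative ladd.
Proof. by move=> f g; apply/fsfunP=> i; rewrite !laddE addrC. Qed.

Lemma ladd0 : left_id lzero ladd.
Proof. by move=> f; apply/fsfunP=> i; rewrite !laddE lzeroE add0r. Qed.

Lemma laddN : left_inverse lzero lopp ladd.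
Proof.
by move=> f; apply/fsfunP=> i; rewrite !laddE loppE lzeroE addNr.
Qed.

Lemma lmulC : commutative lmul.
Proof.
move=> f g; apply/fsfunP=> k; rewrite lmulE.
pose D := (supp f `|` [fset (k - j)%R | j in supp g])%fset.
rewrite -lmulE (@lmulEw D) ?fsubsetUl // lmulEr; last first.
  by move=> j jg; rewrite inE; apply/orP; right; apply/imfsetP; exists j.
by rewrite lmulE; apply: eq_bigr => j _; rewrite mulrC.
Qed.

Lemma lmul1 : left_id lone lmul.
Proof.
move=> f; apply/fsfunP=> k; rewrite (@lmulEw [fset 0%R]%fset).
  by rewrite big_seq_fset1 loneE eqxx mul1r subr0.
by apply/fsubsetP=> i; rewrite mem_finsupp loneE in_fset1; case: (i == 0); rewrite ?eqxx.
Qed.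

Lemma lmulDl : left_distributive lmul ladd.
Proof.
move=> f g h; apply/fsfunP=> k; rewrite laddE.
pose D := (supp f `|` supp g)%fset.
rewrite (@lmulEw D f) ?fsubsetUl // (@lmulEw D g) ?fsubsetUr //.
rewrite (@lmulEw D); last first.
  apply/fsubsetP=> i; rewrite mem_finsupp laddE !inE !mem_finsupp.
  by apply: contraR; rewrite negb_or !negbK => /andP[/eqP-> /eqP->]; rewrite addr0.
by rewrite -big_split; apply: eq_bigr => i _; rewrite laddE mulrDl.
Qed.

Lemma lmulA : associative lmul.
Proof.
move=> f g h; apply/fsfunP=> k; rewrite [LHS]lmulE.
pose D := (supp (lmul f g) `|`
  [fset (i + j)%R | i in supp f, j in supp g])%fset.
rewrite (@lmulEw D (lmul f g)) ?fsubsetUl //.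
under [RHS]eq_bigr do rewrite lmulE mulr_suml.
rewrite exchange_big /= big_seq [RHS]big_seq; apply: eq_bigr => i fi.
under [RHS]eq_bigr do rewrite -mulrA.
rewrite -mulr_sumr; congr (_ * _); rewrite lmulE.
have sD : ([fset (i + j)%R | j in supp g] `<=` D)%fset.
  apply/fsubsetP=> _ /imfsetP[j jg ->]; rewrite inE; apply/orP; right.
  by apply/imfset2P; exists i => //; exists j.
rewrite -(big_fset_incl _ sD) /=; last first.
  move=> l _ nl; rewrite [g _]fsfun_dflt ?mul0r //; apply: contra nl => gl.
  by apply/imfsetP; exists (l - i); rewrite // addrC subrK.
rewrite big_imfset /=; last by move=> a b _ _ /addrI.
by apply: eq_bigr => j _; rewrite [i + j]addrC addrK opprD addrA addrAC.
Qed.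

Lemma lone_neq0 : lone != lzero.
Proof.
by apply/eqP => /fsfunP/(_ 0) /eqP; rewrite loneE lzeroE oner_eq0.
Qed.

HB.instance Definition _ := GRing.isZmodule.Build (laurent K)
  laddA laddC ladd0 laddN.
HB.instance Definition _ := GRing.Zmodule_isComNzRing.Build (laurent K)
  lmulA lmulC lmul1 lmulDl lone_neq0.

End LaurentRing.

(* Valuations are written additively, with v 0 = +oo. *)
Record is_valuation (G : realDomainType) (F : fieldType) (v : F -> \bar G) : Prop :=
  IsValuation {
    val_ninfty : forall x, v x <> -oo%E;
    val_infty : forall x, v x = +oo%E <-> x = 0;
    val_mul : forall x y, v (x * y) = (v x + v y)%E;
    val_add : forall x y, (mine (v x) (v y) <= v (x + y)%R)%E
  }.

(* R1 is the valuation ring of a surjective Z-valued valuation of its quotient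
   field, and Cauchy sequences of R1 converge in R1. *)
Definition complete_dvr (R1 : idomainType) : Prop :=
  exists v1 : {fraction R1} -> \bar int,
    [/\ is_valuation v1,
        forall n : int, exists x, v1 x = n%:E,
        forall x, (0 <= v1 x)%E <-> exists a : R1, x = tofrac a
      & forall u : nat -> R1,
          (forall N : int, exists n0, forall m n, (n0 <= m)%N -> (n0 <= n)%N ->
             (N%:E <= v1 (tofrac (u m - u n)))%E) ->
          exists l : R1, forall N : int, exists n0, forall n, (n0 <= n)%N ->
             (N%:E <= v1 (tofrac (u n - l)))%E].

Definition integral_closure (R1 : idomainType) (K : fieldType)
    (iota : {rmorphism {fraction R1} -> K}) : set K :=
  [set x | integralOver (fun a : R1 => iota (tofrac a)) x].

Definition laurent_over (K : fieldType) (R : set K) : set (laurent K) :=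
  [set f | forall i : int, R (f i)].

Section OptimalDecomposition.
Variables (RR : realType) (K : fieldType) (R : set K) (v : K -> \bar rat).
Implicit Types f g h : laurent K.
Local Open Scope ereal_scope.

Definition gauss_val f : \bar RR :=
  ereal_inf [set er_map ratr (v (f i)) | i in [set: int]].

(* The supremum w(f) over all h in R[x^+-1], taken in the extended reals. *)
Definition sq_val f : \bar RR :=
  ereal_sup [set gauss_val (f - h ^+ 2)%R | h in laurent_over R].

Definition optimal_decomposition f h g : Prop :=
  [/\ laurent_over R h, laurent_over R g, f = (h ^+ 2 + g)%R
    & gauss_val g = sq_val f \/ 2%:E < gauss_val g].

End OptimalDecomposition.

(* "Computed effectively" is relative to exact computation in K: a program is
   a finite, field-independent piece of syntax for a Turing-complete language
   on S-expressions with atoms in K.  Apart from list processing and while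
   loops, its only basic steps are the field operations, the comparison of the
   valuations of two elements and the extraction of one root of a univariate
   polynomial.  In particular the test x = 0 is available, as v 0 <= v x. *)
Inductive data (K : Type) : Type :=
  | DNil
  | DElt of K
  | DCons of data K & data K.
Arguments DNil {K}.

Inductive instr : Type :=
  IOne | IAdd | IOpp | IMul | IInv | ILeV | IRoot.

(* Every program denotes a partial function data K -> data K, see run below. *)
Inductive prog : Type :=
  | PId
  | PNil
  | PCons of prog & prog
  | PHead
  | PTail
  | PComp of prog & prog          (* PComp p q is "p after q" *)
  | PIf of prog & prog & prog     (* DNil is false, everything else is true *)
  | PWhile of prog & prog         (* PWhile c p is "while c x do x := p x" *)
  | PInstr of instr.

Section Semantics.
Variables (K : fieldType) (leV : rel K) (rt : {poly K} -> K).

Definition is_dnil (d : data K) : bool := if d is DNil then true else false.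
Definition dhead (d : data K) : data K := if d is DCons a _ then a else DNil.
Definition dtail (d : data K) : data K := if d is DCons _ b then b else DNil.

Fixpoint elts (d : data K) : seq K :=
  if d is DCons (DElt a) d' then a :: elts d' else [::].

(* Ill-typed instructions return DNil.  IRoot reads the list of coefficients of
   a polynomial in ascending order. *)
Definition exec (c : instr) (d : data K) : data K :=
  match c, d with
  | IOne, _ => DElt 1
  | IAdd, DCons (DElt a) (DElt b) => DElt (a + b)
  | IOpp, DElt a => DElt (- a)
  | IMul, DCons (DElt a) (DElt b) => DElt (a * b)
  | IInv, DElt a => DElt a^-1
  | ILeV, DCons (DElt a) (DElt b) => if leV a b then DCons DNil DNil else DNil
  | IRoot, d => let p := Poly (elts d) in
                if (1 < size p)%N then DElt (rt p) else DNil
  | _, _ => DNil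
  end.

(* run p x y: the (deterministic) execution of p on x halts with result y. *)
Inductive run : prog -> data K -> data K -> Prop :=
  | RunId x : run PId x x
  | RunNil x : run PNil x DNil
  | RunCons p q x y z : run p x y -> run q x z -> run (PCons p q) x (DCons y z)
  | RunHead x : run PHead x (dhead x)
  | RunTail x : run PTail x (dtail x)
  | RunComp p q x y z : run q x y -> run p y z -> run (PComp p q) x z
  | RunIfT c p q x b y : run c x b -> ~~ is_dnil b -> run p x y ->
      run (PIf c p q) x y
  | RunIfF c p q x b y : run c x b -> is_dnil b -> run q x y ->
      run (PIf c p q) x y
  | RunWhileT c p x b y z : run c x b -> ~~ is_dnil b -> run p x y ->
      run (PWhile c p) y z -> run (PWhile c p) x z
  | RunWhileF c p x b : run c x b -> is_dnil b -> run (PWhile c p) x x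
  | RunInstr c x : run (PInstr c) x (exec c x).

Definition code_nat (n : nat) : data K := iter n (DCons DNil) DNil.
Definition code_seq (s : seq K) : data K :=
  foldr (fun a d => DCons (DElt a) d) DNil s.

(* codes f d: d encodes a pair (n, s) with f = x^(-n) * \sum_j s_j x^j; leading
   and trailing zeros are allowed, so that codes are not unique. *)
Definition codes (f : laurent K) (d : data K) : Prop :=
  exists (n : nat) (s : seq K), d = DCons (code_nat n) (code_seq s) /\
    forall i : int, f i = if i + n%:Z is Posz j then s`_j else 0.

End Semantics.

Definition root_oracle (K : fieldType) (rt : {poly K} -> K) : Prop :=
  forall p : {poly K}, (1 < size p)%N -> root p (rt p).

(* Main.v *)
Require Import Defs.
From HB Require Import structures.
From mathcomp Require Import all_boot all_order all_algebra.
From mathcomp Require Import finmap.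
From mathcomp Require Import boolp classical_sets reals constructive_ereal ereal.
From mathcomp Require Import ring lra zify.

Set Implicit Arguments.
Unset Strict Implicit.
Unset Printing Implicit Defensive.

Import Order.TTheory GRing.Theory Num.Theory.

Local Open Scope classical_set_scope.
Local Open Scope ring_scope.

(* Let f = h^2 + g, and suppose that h' = h + e satisfies v(f - h'^2) > v(g),
   where f - h'^2 = g - 2 h e - e^2.  If g has only odd exponents and v(g) <= 2,
   looking at the lowest term of minimal valuation of e shows v(g) = 2 and
   v(e) >= 1, so that e/2 solves E^2 + h E = g/4 modulo the maximal ideal.

   Such an h is found exactly: writing the even part of f as F(x^2) and h as
   a(x^2) + x b(x^2), one needs a^2 + y b^2 = F(y), a multiplicative condition
   which is solved one root of F at a time.  The equation E^2 + h E = g/4 over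
   the residue field has at most two solutions E and - h - E, which differ first
   at the lowest index a where h_a is a unit.  The coefficients of a solution are
   determined in increasing order, E_i by coefficient 2i if i <= a and by
   coefficient a + i if i > a.  The computed E is a solution if there is one, and
   then h + 2 E yields a remainder of valuation > 2; otherwise h is optimal. *)

(** * Valuations and Laurent polynomials *)

Section Valuation.
Variables (K : fieldType) (v : K -> \bar rat).
Hypothesis hv : is_valuation v.

Lemma val0 : v 0 = +oo%E.
Proof. exact/(val_infty hv). Qed.

Lemma val_fin x : x != 0 -> exists r, v x = r%:E.
Proof.
move=> x0; case E: (v x) => [r||]; first by exists r.
- by move: x0; rewrite (val_infty hv x).1 ?eqxx.
- by case: (val_ninfty hv E).
Qed.

Lemma val1 : v 1 = 0%:E.
Proof.
have [r vr] := val_fin (oner_neq0 K).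
have := val_mul hv 1 1; rewrite mulr1 vr -EFinD => -[] h.
by congr EFin; lra.
Qed.

Lemma valN x : v (- x) = v x.
Proof.
have n1 : v (-1) = 0%:E.
  have [r vr] : exists r, v (-1) = r%:E by apply: val_fin; rewrite oppr_eq0 oner_neq0.
  have := val_mul hv (-1) (-1); rewrite mulrNN mulr1 vr val1 -EFinD => -[] h.
  by congr EFin; lra.
by rewrite -mulN1r (val_mul hv) n1 add0e.
Qed.

Lemma val_geD (B : \bar rat) x y : (B <= v x -> B <= v y -> B <= v (x + y)%R)%E.
Proof. by move=> bx by_; apply: le_trans (val_add hv x y); rewrite le_min bx. Qed.

Lemma val_gtD (B : \bar rat) x y : (B < v x -> B < v y -> B < v (x + y)%R)%E.
Proof. by move=> bx by_; apply: lt_le_trans (val_add hv x y); rewrite lt_min bx. Qed.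

Lemma val_geB (B : \bar rat) x y : (B <= v x -> B <= v y -> B <= v (x - y)%R)%E.
Proof. by move=> bx by_; apply: val_geD; rewrite ?valN. Qed.

Lemma val_gtB (B : \bar rat) x y : (B < v x -> B < v y -> B < v (x - y)%R)%E.
Proof. by move=> bx by_; apply: val_gtD; rewrite ?valN. Qed.

Lemma val_ge_sum (B : \bar rat) I (r : seq I) (P : pred I) (F : I -> K) :
  (forall i, P i -> B <= v (F i))%E -> (B <= v (\sum_(i <- r | P i) F i)%R)%E.
Proof.
move=> h; elim/big_ind : _ => //; first by rewrite val0 leey.
exact: val_geD.
Qed.

Lemma val_gt_sum (B : \bar rat) (I : eqType) (r : seq I) (P : pred I) (F : I -> K) :
  (B < +oo)%E -> (forall i, i \in r -> P i -> B < v (F i))%E ->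
  (B < v (\sum_(i <- r | P i) F i)%R)%E.
Proof.
move=> hB h; rewrite big_seq_cond; elim/big_ind : _ => //; first by rewrite val0.
  exact: val_gtD.
by move=> i /andP[]; exact: h.
Qed.

(** If [v y] exceeded [v x], then so would the valuation of [x = y - (y - x)]. *)
Lemma val_dominated x y : (v x < v (y - x)%R)%E -> v y = v x.
Proof.
move=> h; apply/eqP; rewrite eq_le; apply/andP; split.
  rewrite leNgt; apply/negP => xy.
  have : (v x < v (y - (y - x))%R)%E by apply: val_gtB.
  by rewrite subKr ltxx.
by rewrite -(subrK x y); apply: val_geD => //; exact: ltW.
Qed.

Lemma val_ge0M x y : (0%:E <= v x -> 0%:E <= v y -> 0%:E <= v (x * y)%R)%E.
Proof. by move=> hx hy; rewrite (val_mul hv) adde_ge0. Qed.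

Lemma val_gt0Ml x y : (0%:E < v x -> 0%:E <= v y -> 0%:E < v (x * y)%R)%E.
Proof.
move=> hx hy; rewrite (val_mul hv); case: (v x) (v y) hx hy => [a||] [b||] //.
by rewrite -EFinD !lte_fin lee_fin => ? ?; lra.
Qed.

Lemma val_gt0Mr x y : (0%:E <= v x -> 0%:E < v y -> 0%:E < v (x * y)%R)%E.
Proof. by move=> hx hy; rewrite mulrC; apply: val_gt0Ml. Qed.

Lemma val_gt0_prime x y : (0%:E <= v x -> 0%:E <= v y ->
  0%:E < v (x * y)%R -> (0%:E < v x) || (0%:E < v y))%E.
Proof.
rewrite (val_mul hv); case: (v x) (v y) => [a||] [b||] //=; rewrite ?orbT //.
rewrite -EFinD !lte_fin !lee_fin => ? ? ?; apply/orP.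
have [|] := ltrP 0 a; first by left.
by move=> ?; right; lra.
Qed.

Lemma exists_min (T : eqType) (r : rel T) (s : seq T) :
  total r -> transitive r -> s != [::] -> exists2 x, x \in s & {in s, forall y, r x y}.
Proof.
move=> tot tr; elim: s => // x s IHs _.
have rr y : r y y by have := tot y y; rewrite orbb.
have [->|s0] := eqVneq s [::].
  by exists x; rewrite ?mem_head // => y; rewrite inE => /eqP->.
have [m ms hm] := IHs s0; have /orP[xm|mx] := tot x m.
  exists x; rewrite ?mem_head // => y; rewrite inE => /orP[/eqP->//|/hm].
  exact: tr.
by exists m; rewrite ?inE ?ms ?orbT // => y /predU1P[->//|/hm].
Qed.

Implicit Types a b e f g h : laurent K.

Lemma coef_out f i : i \notin finsupp f -> f i = 0.
Proof. exact: fsfun_dflt. Qed.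

Lemma laurent_neq0 f : f != 0 -> exists i, f i != 0.
Proof.
move=> f0; apply: contrapT => h; case/eqP: f0; apply/fsfunP => i.
by rewrite [RHS]lzeroE; apply: contrapT => /eqP fi; apply: h; exists i.
Qed.

Lemma gauss_index f : f != 0 ->
  exists j, [/\ f j != 0, forall l, (v (f j) <= v (f l))%E
              & forall l, l < j -> (v (f j) < v (f l))%E].
Proof.
move=> /laurent_neq0[i fi].
(* Ordering the support lexicographically, first by valuation and then by index, makes the minimum
   the lowest index of minimal valuation. *)
pose r := [rel l m : int | (v (f l) < v (f m))%E || (v (f l) == v (f m)) && (l <= m)].
have tot : total r.
  by move=> l m /=; case: ltgtP => //= _; exact: le_total.
have tr : transitive r.
  move=> y x z /= /orP[xy|/andP[/eqP-> xy]] /orP[yz|/andP[/eqP<- yz]].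
  - by rewrite (lt_trans xy yz).
  - by rewrite xy.
  - by rewrite yz.
  - by rewrite eqxx (le_trans xy yz) orbT.
have s0 : (finsupp f : seq int) != [::].
  by have : i \in (finsupp f : seq int); [rewrite mem_finsupp|case: (X in X != [::])].
have [j js hj] := exists_min tot tr s0.
have fj0 : f j != 0 by rewrite -mem_finsupp.
have [c vc] := val_fin fj0.
exists j; split=> //.
- move=> l; have [/hj /=|/coef_out->] := boolP (l \in finsupp f).
    by case/orP=> [/ltW//|/andP[/eqP->]].
  by rewrite val0 leey.
- move=> l lj; have [/hj /=|/coef_out->] := boolP (l \in finsupp f).
    by case/orP=> [//|/andP[_]]; rewrite leNgt lj.
  by rewrite val0 vc ltry.
Qed.

Lemma coefD f g i : (f + g) i = f i + g i. Proof. exact: laddE. Qed.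
Lemma coefN f i : (- f) i = - f i. Proof. exact: loppE. Qed.
Lemma coefB f g i : (f - g) i = f i - g i. Proof. by rewrite coefD coefN. Qed.
Lemma coef_mul2 f i : (f *+ 2) i = f i *+ 2. Proof. by rewrite !mulr2n coefD. Qed.

Lemma coefM_dominated (B : \bar rat) a b i k : (B < +oo)%E ->
  (forall l, l != i -> B < v (a l * b (k - l))%R)%E ->
  (B < v ((a * b)%R k - a i * b (k - i))%R)%E.
Proof.
move=> hB h; rewrite [(a * b) k](lmulEw (D := (finsupp a `|` [fset i])%fset)) ?fsubsetUl //.
rewrite (bigD1_seq i) ?fset_uniq ?inE ?eqxx ?orbT //= addrAC subrr add0r.
by apply: val_gt_sum => // l _; apply: h.
Qed.

Lemma coefM_ge (B : \bar rat) a b k :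
  (forall l, B <= v (a l * b (k - l))%R)%E -> (B <= v ((a * b)%R k))%E.
Proof. by move=> h; rewrite [(a * b) k]lmulE; apply: val_ge_sum. Qed.

Lemma coefM_gt (B : \bar rat) a b k : (B < +oo)%E ->
  (forall l, B < v (a l * b (k - l))%R)%E -> (B < v ((a * b)%R k))%E.
Proof. by move=> hB h; rewrite [(a * b) k]lmulE; apply: val_gt_sum. Qed.

(** In coefficient 2j of the square, every product other than [e j * e j] has a factor of index
    below j, hence a strictly larger valuation. No factor 2 arises at this index, which makes even
    exponents special. *)
Lemma sqr_lowest_coef e (j : int) : e j != 0 -> (forall l, v (e j) <= v (e l))%E ->
  (forall l, l < j -> (v (e j) < v (e l))%E) -> v ((e ^+ 2) (j + j)) = (v (e j) + v (e j))%E.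
Proof.
move=> ej0 hmin hlow; rewrite -(val_mul hv); apply: val_dominated.
have [c vc] := val_fin ej0.
have hlt l m : (v (e j) < v (e l))%E -> (v (e j * e j)%R < v (e l * e m)%R)%E.
  rewrite !(val_mul hv) vc => h1; have := hmin m; rewrite vc => h2.
  case: (v (e l)) (v (e m)) h1 h2 => [x||] [y||] //=; rewrite -?EFinD ?ltry //.
  by rewrite !lte_fin lee_fin => ? ?; lra.
rewrite expr2 -[X in (_ - _ * e X)%R](addrK j) .
apply: coefM_dominated; first by rewrite (val_mul hv) vc -EFinD ltry.
move=> l; case: (ltgtP l j) => // lj _; first by apply: hlt; apply: hlow.
by rewrite [e l * _]mulrC; apply: hlt; apply: hlow; lia.
Qed.

End Valuation.

(** * Consequences of a better square approximation *)

Section Improvement.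
Variables (K : fieldType) (v : K -> \bar rat).
Hypotheses (hv : is_valuation v) (v2 : v 2%:R = 1%:E).
Implicit Types a b e f g h : laurent K.

Lemma val_mul2 x : v (x *+ 2) = (1%:E + v x)%E.
Proof. by rewrite -mulr_natl (val_mul hv) v2. Qed.

Lemma val_mul4 x : v (x *+ 4) = (2%:E + v x)%E.
Proof. by rewrite (mulrnA x 2 2) !val_mul2 addeA. Qed.

Lemma laurent_half e : exists e', e = e' *+ 2.
Proof.
exists ([fsfun i in finsupp e => e i / 2%:R] : laurent K); apply/fsfunP => i.
have n2 : 2%:R != 0 :> K by apply/eqP => /(val_infty hv); rewrite v2.
rewrite coef_mul2 fsfunE; case: finsuppP => _; first by rewrite mul0rn.
by rewrite -[RHS]mulr_natr divfK.
Qed.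

(** If h were not integral, its lowest coefficient of minimal valuation would appear squared in an
    even coefficient of h^2. This gives integrality of the computed h, which is known only through
    the even part of its square. *)
Lemma integral_of_sqr_even h :
  (forall k : int, 0%:E <= v ((h ^+ 2)%R (k + k)%R))%E ->
  forall l, (0%:E <= v (h l))%E.
Proof.
move=> hh l; rewrite leNgt; apply/negP => hl.
have h0 : h != 0.
  by apply/eqP => E; move: hl; rewrite E [lzero _ _]lzeroE (val0 hv).
have [j [hj0 hmin hlow]] := gauss_index hv h0.
have := hh j; rewrite (sqr_lowest_coef hv hj0 hmin hlow).
have [c vc] := val_fin hv hj0; have := le_lt_trans (hmin l) hl.
by rewrite vc -EFinD lte_fin lee_fin; clear - hv v2; move=> ? ?; lra.
Qed.

Lemma improvement f h g g4 h' (i0 : int) :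
  (forall l, 0%:E <= v (h l))%E -> (forall l, 0%:E <= v (h' l))%E ->
  f = h ^+ 2 + g -> (forall k : int, g (k + k) = 0) -> g = g4 *+ 4 ->
  (forall l, v (g i0) <= v (g l))%E -> (v (g i0) <= 2%:E)%E ->
  (forall l, v (g i0) < v ((f - h' ^+ 2)%R l))%E ->
  v (g i0) = 2%:E /\
  exists E : laurent K, (forall l, 0%:E <= v (E l))%E
    /\ (forall l, 0%:E < v ((g4 - h * E - E ^+ 2)%R l))%E.
Proof.
move=> hO h'O -> gev g4E gmin g2 better.
pose e := h' - h; pose q := (h * e) *+ 2 + e ^+ 2.
have E1 : h ^+ 2 + g - h' ^+ 2 = g - q.
  by rewrite /q /e; ring.
rewrite E1 in better.
have [t vt] : exists t, v (g i0) = t%:E.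
  apply: (val_fin hv); apply/eqP => g0.
  by move: g2; rewrite g0 (val0 hv).
have eO l : (0%:E <= v (e l))%E by rewrite coefB; apply: val_geB.
(* The term [q] has to cancel the coefficient of [g] at [i0], so it cannot have larger valuation
   there. *)
have q_i0 : (v (q i0) <= t%:E)%E.
  rewrite -vt leNgt; apply/negP => qlt.
  have := val_gtD hv (better i0) qlt; rewrite coefB subrK.
  by rewrite ltxx.
have e0 : e != 0.
  apply/eqP => e0; move: q_i0; rewrite /q e0 mulr0 mul0rn expr0n /= addr0.
  by rewrite [lzero _ _]lzeroE (val0 hv).
have [j [ej0 emin elow]] := gauss_index hv e0.
have [s vs] := val_fin hv ej0; rewrite vs in emin elow.
have s0 : 0 <= s by have := eO j; rewrite vs lee_fin.
have he2 l : ((1 + s)%:E <= v ((h * e *+ 2)%R l))%E.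
  rewrite coef_mul2 val_mul2 EFinD leeD2l //; apply: coefM_ge => // m.
  by rewrite (val_mul hv) -[X in (X <= _)%E]add0e leeD.
have ee l : ((s + s)%:E <= v ((e ^+ 2)%R l))%E.
  rewrite expr2; apply: coefM_ge => // m.
  by rewrite (val_mul hv) EFinD leeD.
have qlow l : ((Num.min (1 + s) (s + s))%:E <= v (q l))%E.
  rewrite coefD; apply: val_geD => //.
    by apply: le_trans (he2 l); rewrite lee_fin ge_min lexx.
  by apply: le_trans (ee l); rewrite lee_fin ge_min lexx orbT.
(* If s < 1, then e^2 dominates 2 h e at the index 2 j, where g vanishes. *)
have s1 : 1 <= s.
  rewrite leNgt; apply/negP => s1.
  have vq : v (q (j + j)) = (s + s)%:E.
    have <- : v ((e ^+ 2) (j + j)) = (s + s)%:E.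
      by rewrite (sqr_lowest_coef hv ej0) ?vs.
    apply: val_dominated => //; rewrite coefD addrK (sqr_lowest_coef hv ej0) ?vs //.
    apply: lt_le_trans (he2 _); rewrite -EFinD lte_fin; move: s1; clear - hv v2; lra.
  (* At 2j only [q] contributes, so 2s > t; but for s < 1 the lower bound for [q] is 2s, and at [i0]
     it gives 2s <= t. *)
  have := better (j + j); rewrite coefB gev sub0r valN // vq vt lte_fin => ts.
  have := le_trans (qlow i0) q_i0; rewrite lee_fin; move: ts s1; clear - hv v2; case: (leP (1 + s) (s + s)) => ? ? ? ?; lra.
(* Both 1 + s and 2s are now at least 2, so [q_i0] gives t >= 2. *)
have t2 : t = 2.
  have := le_trans (qlow i0) q_i0; move: g2; rewrite vt !lee_fin.
  by move: s1; clear - hv v2; case: (leP (1 + s) (s + s)) => ? ? ? ?; lra.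
split; first by rewrite vt t2.
have [E eE] := laurent_half e.
exists E; split.
  move=> l; have := emin l; rewrite eE coef_mul2 val_mul2.
  case: (v (E l)) => [r||] //; rewrite -EFinD !lee_fin; move: s1; clear - hv v2; move=> ? ?; lra.
move=> l; have := better l; rewrite vt t2.
have -> : g - q = (g4 - h * E - E ^+ 2) *+ 4 by rewrite /q eE g4E; ring.
rewrite (mulrnA _ 2 2) !coef_mul2 !val_mul2.
case: (v _) => [r||] //; rewrite -!EFinD !lte_fin; clear - hv v2; move=> ?; lra.
Qed.

End Improvement.

(** * Solving the quadratic equation modulo the maximal ideal *)

Section Approximation.
Variables (K : fieldType) (v : K -> \bar rat).
Hypotheses (hv : is_valuation v) (v2 : v 2%:R = 1%:E).
Implicit Types a b d e f g h E : laurent K.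

Local Notation O x := (Order.le (0%R)%:E (v x)).
Local Notation M x := (Order.lt (0%R)%:E (v x)).

(** The defect of e as a root of E^2 + h E = g. In this section g stands for the remainder already
    divided by 4. *)
Definition residual g h e : laurent K := g - h * e - e ^+ 2.

Lemma integral_coefM a b k : (forall l, O (a l)) -> (forall l, O (b l)) -> O ((a * b) k).
Proof. by move=> aO bO; apply: coefM_ge => // l; apply: val_ge0M. Qed.

Lemma small_coefMl a b k : (forall l, M (a l)) -> (forall l, O (b l)) -> M ((a * b) k).
Proof. by move=> aM bO; apply: coefM_gt => // l; apply: val_gt0Ml. Qed.

Lemma small_mul2 x : O x -> M (x *+ 2).
Proof.
rewrite (val_mul2 hv v2); case: (v x) => [r||] //.
by rewrite -EFinD lte_fin lee_fin; clear - hv v2; move=> ?; lra.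
Qed.

Lemma coefM_residue a b (i j : int) : (forall l, O (a l)) -> (forall l, O (b l)) ->
  (forall l, l != i -> M (a l) \/ M (b (i + j - l))) -> M ((a * b) (i + j) - a i * b j).
Proof.
move=> aO bO hab; have {2}-> : j = i + j - i by rewrite addrAC subrr add0r.
apply: coefM_dominated => // l /hab[] h; first exact: val_gt0Ml.
exact: val_gt0Mr.
Qed.

(** The cross term is isolated with its factor 2: for integral [e] and [E] it has positive valuation
    and drops out of all congruences. *)
Lemma residual_shift g h e E k : residual g h e k =
  residual g h E k + ((E - e) * h) k + ((E - e) ^+ 2) k + (e * (E - e)) k *+ 2.
Proof.
have -> : residual g h e =
    residual g h E + (E - e) * h + (E - e) ^+ 2 + (e * (E - e)) *+ 2.
  by rewrite /residual; ring.
by rewrite !mulr2n !coefD.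
Qed.

(** The two roots of the quadratic equation have sum - h. *)
Lemma residual_swap g h E : residual g h (- h - E) = residual g h E.
Proof. by rewrite /residual; ring. Qed.

(** The order is a parameter so that the lemma yields both the lowest and the highest coefficient
    outside the maximal ideal. *)
Lemma not_small_extremal (r : rel int) E l : total r -> transitive r -> ~ M (E l) ->
  exists m, [/\ ~ M (E m), r m l & forall k, ~~ r m k -> M (E k)].
Proof.
move=> tot tr nl; pose s := [seq m <- finsupp E | ~~ `[< M (E m) >]].
have ins k : ~ M (E k) -> k \in s.
  move=> nk; rewrite mem_filter; apply/andP; split; first exact/asboolPn.
  by rewrite mem_finsupp; apply/eqP => k0; apply: nk; rewrite k0 (val0 hv).
have s0 : s != [::] by apply: contraTneq (ins _ nl) => ->.
have [m ms hm] := exists_min tot tr s0; exists m; split.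
- by move: ms; rewrite mem_filter => /andP[/asboolPn].
- exact/hm/ins.
- by move=> k; apply: contraNP => /ins /hm.
Qed.

(** Modulo the maximal ideal, coefficient 2m of the residual reduces to - E_m^2, and the ideal is
    prime. *)
Lemma small_at_extremal g h E m :
  (forall l, O (E l)) -> M (residual g h E (m + m)) -> g (m + m) = 0 ->
  M ((h * E) (m + m)) -> (forall k, k != m -> M (E k) \/ M (E (m + m - k))) ->
  M (E m).
Proof.
move=> EO rM g0 hE Ek; suff : M (E m * E m).
  by move=> /(val_gt0_prime hv (EO _) (EO _)); rewrite orbb.
have EE : M ((E * E) (m + m) - E m * E m) by apply: coefM_residue.
have -> : E m * E m = - ((E * E) (m + m) - E m * E m) - residual g h E (m + m)
    - (h * E) (m + m).
  by rewrite /residual !coefB -expr2 g0; ring.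
by apply: val_gtB => //; apply: val_gtB => //; rewrite valN.
Qed.

(** Let m < lo be the lowest index where E is not small. In coefficient 2m of h E, a factor of E
    below m is small, and one of index at least m meets a coefficient of h below lo, which is
    zero. *)
Lemma small_residual_below g h E (lo : int) :
  (forall l, O (h l)) -> (forall l, O (E l)) -> (forall l, M (residual g h E l)) ->
  (forall l, l < lo -> h l = 0) -> (forall l, l < lo + lo -> g l = 0) ->
  forall l, l < lo -> M (E l).
Proof.
move=> hO EO rM hlo glo l llo; apply: contrapT => nl.
have [m [nm ml mlow]] := not_small_extremal le_total le_trans nl.
have {}mlow k : k < m -> M (E k) by rewrite ltNge => /mlow.
apply: nm; apply: (small_at_extremal (g := g) (h := h)) => //.
- by apply: glo; lia.
- rewrite mulrC; apply: coefM_gt => // k; have [km|mk] := ltrP k m.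
    by apply: val_gt0Ml => //; apply: mlow.
  by rewrite hlo ?mulr0 ?(val0 hv) //; lia.
- by move=> k; case: (ltgtP k m) => // km _; [left | right]; apply: mlow => //; lia.
Qed.

(** The mirror image of [small_residual_below], using the highest index where E is not small. *)
Lemma small_residual_above g h E (hi : int) :
  (forall l, O (h l)) -> (forall l, O (E l)) -> (forall l, M (residual g h E l)) ->
  (forall l, hi <= l -> h l = 0) -> (forall l, hi + hi <= l -> g l = 0) ->
  forall l, hi <= l -> M (E l).
Proof.
move=> hO EO rM hhi ghi l lhi; apply: contrapT => nl.
have [m [nm lm mhigh]] := not_small_extremal ge_total ge_trans nl.
have {}mhigh k : m < k -> M (E k) by rewrite ltNge => /mhigh.
rewrite /= in lm; apply: nm; apply: (small_at_extremal (g := g) (h := h)) => //.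
- by apply: ghi; lia.
- rewrite mulrC; apply: coefM_gt => // k; have [km|mk] := ltrP m k.
    by apply: val_gt0Ml => //; apply: mhigh.
  by rewrite hhi ?mulr0 ?(val0 hv) //; lia.
- by move=> k; case: (ltgtP k m) => // km _; [right | left]; apply: mhigh => //; lia.
Qed.

(** The loop invariant. The solution E is existentially quantified because a later coefficient may
    follow the other solution. *)
Definition approximates g h (i : int) e : Prop :=
  [/\ forall l, O (e l), forall l, i <= l -> e l = 0
    & exists E, [/\ forall l, O (E l), forall l, M (residual g h E l)
                & forall l, l < i -> M (E l - e l)]].

(** For i <= a the quadratic congruence at 2i leaves two candidates for the new coefficient. Both
    extend the known ones, since the two solutions agree modulo the maximal ideal below a. For i >
    a, coefficient i + a is linear in the unknown, with unit factor [h a]. *)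
Lemma approximates_step g h (a i : int) e X e' :
  (forall l, O (h l)) -> ~ M (h a) -> (forall l, l < a -> M (h l)) ->
  approximates g h i e ->
  (i <= a -> X ^+ 2 + h i * X = residual g h e (i + i)) ->
  (a < i -> X * h a = residual g h e (i + a)) ->
  (forall l, e' l = if l == i then X else e l) ->
  approximates g h (i + 1) e'.
Proof.
move=> hO ha hlow [eO eout [E [EO rM close]]] Xle Xgt e'E.
have e'out l : i + 1 <= l -> e' l = 0.
  by move=> il; rewrite e'E; case: eqP => [?|_]; [lia|apply: eout; lia].
pose d := E - e.
have dE l : d l = E l - e l by exact: coefB.
have dO l : O (d l) by rewrite dE; apply: val_geB.
have dM l : l < i -> M (d l) by move=> ?; rewrite dE; apply: close.
have di : d i = E i by rewrite dE eout ?subr0.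
(* Modulo the maximal ideal, [d * h] contributes only [E i * h j] at i + j: [d] is small below i,
   and h is small below j. *)
have key j : (forall l, i < l -> M (h (i + j - l))) ->
    M (residual g h e (i + j) - (d ^+ 2) (i + j) - E i * h j).
  move=> hj; rewrite (residual_shift g h e E) -/d -di.
  have : M ((d * h) (i + j) - d i * h j).
    apply: coefM_residue => // l; case: (ltgtP l i) => // li _; [left|right].
      exact: dM.
    exact: hj.
  move=> h1; have h2 : M ((e * d) (i + j) *+ 2).
    by apply: small_mul2; apply: integral_coefM.
  have -> : forall u w x y z : K, u + w + x + y - x - z = u + (w - z) + y by move=> *; ring.
  by do !apply: val_gtD => //.
have rO l : O (residual g h e l).
  rewrite (residual_shift g h e E) -/d expr2.
  apply: val_geD => //; last by apply/ltW/small_mul2/integral_coefM.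
  by apply: val_geD => //; [apply: val_geD => //; [exact: ltW|]|];
    apply: integral_coefM.
have [ia|ai] := lerP i a.
- have {}Xle := Xle ia.
  (* X is a root of a monic quadratic polynomial with integral coefficients. *)
  have XO : O X.
    rewrite leNgt; apply/negP => X0.
    have [x vx] : exists x, v X = x%:E.
      by apply: (val_fin hv); apply/eqP => E0; move: X0; rewrite E0 (val0 hv).
    have : (v X <= v (X ^+ 2)%R)%E.
      have -> : X ^+ 2 = residual g h e (i + i) - h i * X by rewrite -Xle addrK.
      apply: val_geB => //; first exact: le_trans (ltW X0) (rO _).
      by rewrite (val_mul hv) -[X in (X <= _)%E]add0e leeD.
    rewrite expr2 (val_mul hv) vx -EFinD lee_fin; move: X0; rewrite vx lte_fin.
    by clear - hv v2; move=> ? ?; lra.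
  have h1 : M (residual g h e (i + i) - (d ^+ 2) (i + i) - E i * h i).
    by apply: key => l il; apply: hlow; lia.
  (* X satisfies the same quadratic congruence as [E i], whose roots are [E i] and [- h i - E i]. *)
  have {h1} : M ((X - E i) * (X + E i + h i)).
    have -> : (X - E i) * (X + E i + h i)
        = residual g h e (i + i) - (d ^+ 2) (i + i) - E i * h i + ((d ^+ 2) (i + i) - E i * E i).
      by rewrite -Xle; ring.
    apply: val_gtD => //.
    rewrite expr2 -di; apply: coefM_residue => // l.
    by case: (ltgtP l i) => // li _; [left|right]; apply: dM; lia.
  have e'O l : O (e' l) by rewrite e'E; case: eqP.
  move=> /(val_gt0_prime hv); case/(_ _ _)/orP.
  + exact: val_geB.
  + by do !apply: val_geD => //.
  + move=> h1; split=> //; exists E; split=> // l li; rewrite e'E; case: eqP => [->|/eqP ne].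
      by rewrite -(valN hv) opprB.
    by apply: close; lia.
  (* [- h - E] has the same residual as [E] and is congruent to [E] below [a]. *)
  + move=> h1; split=> //; exists (- h - E); split.
    * by move=> l; rewrite coefB coefN; apply: val_geB => //; rewrite valN.
    * by move=> l; rewrite residual_swap.
    * move=> l li; rewrite coefB coefN e'E; case: eqP => [->|/eqP ne].
        rewrite -(valN hv); congr (_ < v _)%E: h1; ring.
      have -> : - h l - E l - e l = - h l - (E l - e l) - e l *+ 2 by ring.
      apply: val_gtB => //; last exact: small_mul2.
      by apply: val_gtB => //; [rewrite valN //; apply: hlow; lia | apply: close; lia].
- have {}Xgt := Xgt ai.
  have hXd : M (h a * (X - E i)).
    have -> : h a * (X - E i) = residual g h e (i + a) - (d ^+ 2) (i + a) - E i * h a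
       + (d ^+ 2) (i + a) by rewrite -Xgt; ring.
    apply: val_gtD => //; first by apply: key => l il; apply: hlow; lia.
    rewrite expr2; apply: coefM_gt => // l; have [li|il] := ltrP l i.
      by apply: val_gt0Ml => //; apply: dM.
    by apply: val_gt0Mr => //; apply: dM; lia.
  (* Dividing by [h a] preserves integrality because its valuation is 0. *)
  have XO : O X.
    have : O (X * h a) by rewrite Xgt.
    have -> : v (X * h a) = v X; last by [].
    have : v (h a) = 0%:E by apply/eqP; rewrite eq_le hO leNgt; apply/andP; split=> //; apply/negP.
    by move=> h0; rewrite (val_mul hv) h0 adde0.
  have XE : M (X - E i).
    have /(val_gt0_prime hv (hO _)) := hXd.
    by case/(_ (val_geB hv XO (EO _)))/orP.
  split=> //; first by move=> l; rewrite e'E; case: eqP.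
  exists E; split=> // l li; rewrite e'E; case: eqP => [->|/eqP ne].
    by rewrite -(valN hv) opprB.
  by apply: close; lia.
Qed.

(** From hi on every solution is small and e vanishes, so e is congruent to a solution at all
    indices and inherits its small residual. *)
Lemma approximates_end g h (hi : int) e :
  (forall l, O (h l)) ->
  (forall l, hi <= l -> h l = 0) -> (forall l, hi + hi <= l -> g l = 0) ->
  approximates g h hi e -> forall l, M (residual g h e l).
Proof.
move=> hO hhi ghi [eO eout [E [EO rM close]]] l.
have dM m : M ((E - e) m).
  rewrite coefB; have [mhi|him] := ltrP m hi; first exact: close.
  rewrite eout // subr0; exact: (small_residual_above hO EO rM hhi ghi).
rewrite (residual_shift g h e E) expr2.
have dO m : O ((E - e) m) by apply: ltW.
apply: val_gtD => //; last by apply: small_mul2; apply: integral_coefM.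
apply: val_gtD => //; last exact: small_coefMl.
by apply: val_gtD => //; exact: small_coefMl.
Qed.

Lemma approximates_start g h E (lo : int) :
  (forall l, O (h l)) -> (forall l, O (E l)) -> (forall l, M (residual g h E l)) ->
  (forall l, l < lo -> h l = 0) -> (forall l, l < lo + lo -> g l = 0) ->
  approximates g h lo 0.
Proof.
move=> hO EO rM hlo glo; split.
- by move=> l; rewrite [lzero _ _]lzeroE (val0 hv).
- by move=> l _; rewrite [lzero _ _]lzeroE.
- exists E; split=> // l llo; rewrite [lzero _ _]lzeroE subr0.
  exact: (small_residual_below hO EO rM hlo glo).
Qed.

End Approximation.

(** * A total language compiled to programs *)

(* A total sublanguage of prog.  Data is read as an environment, a list of
   values; the body of TFold sees the current element and the accumulator in
   front of the environment. *)
Inductive tm : Type :=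
  | TEnv
  | TNil
  | TCons of tm & tm
  | THead of tm
  | TTail of tm
  | TIf of tm & tm & tm
  | TSub of tm & tm
  | TFold of tm & tm & tm
  | TOp of instr & tm.

(** A fold becomes a while loop on states (remaining list . (accumulator . environment)), so that
    [PHead] serves as the loop condition. *)
Fixpoint compile (t : tm) : prog :=
  match t with
  | TEnv => PId
  | TNil => PNil
  | TCons a b => PCons (compile a) (compile b)
  | THead a => PComp PHead (compile a)
  | TTail a => PComp PTail (compile a)
  | TIf c a b => PIf (compile c) (compile a) (compile b)
  | TSub t a => PComp (compile t) (compile a)
  | TFold l a p =>
      PComp (PComp PHead PTail)
        (PComp
           (PWhile PHead
              (PCons (PComp PTail PHead)
                 (PCons (PComp (compile p) (PCons (PComp PHead PHead) PTail))
                    (PComp PTail PTail))))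
           (PCons (compile l) (PCons (compile a) PId)))
  | TOp c a => PComp (PInstr c) (compile a)
  end.

Section Eval.
Variables (K : fieldType) (leV : rel K) (rt : {poly K} -> K).

(* An atom in list position is traversed once, as the empty cell. *)
Fixpoint foldd (F : data K -> data K -> data K) (l acc : data K) : data K :=
  match l with
  | DNil => acc
  | DElt _ => F DNil acc
  | DCons c l' => foldd F l' (F c acc)
  end.

Fixpoint eval (t : tm) (env : data K) : data K :=
  match t with
  | TEnv => env
  | TNil => DNil
  | TCons a b => DCons (eval a env) (eval b env)
  | THead a => dhead (eval a env)
  | TTail a => dtail (eval a env)
  | TIf c a b => if is_dnil (eval c env) then eval b env else eval a env
  | TSub t a => eval t (eval a env)
  | TFold l a p =>
      foldd (fun c acc => eval p (DCons c (DCons acc env))) (eval l env) (eval a env)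
  | TOp c a => exec leV rt c (eval a env)
  end.

Lemma run_compile t env : run leV rt (compile t) env (eval t env).
Proof.
elim: t env => /=.
- by move=> env; apply: RunId.
- by move=> env; apply: RunNil.
- by move=> a IHa b IHb env; apply: RunCons.
- by move=> a IHa env; apply: RunComp (IHa _) (RunHead _ _ _).
- by move=> a IHa env; apply: RunComp (IHa _) (RunTail _ _ _).
- move=> c IHc a IHa b IHb env; case: ifPn => hc.
  + exact: RunIfF (IHc _) hc (IHb _).
  + exact: RunIfT (IHc _) hc (IHa _).
- by move=> t IHt a IHa env; apply: RunComp (IHa _) (IHt _).
- move=> l IHl a IHa p IHp env.
  set body := PCons _ (PCons (PComp (compile p) _) _).
  set F := fun c acc => _.
  have loop (d acc : data K) : exists d', run leV rt (PWhile PHead body)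
      (DCons d (DCons acc env)) (DCons d' (DCons (foldd F d acc) env)).
    have step d0 acc0 : run leV rt body (DCons d0 (DCons acc0 env))
        (DCons (dtail d0) (DCons (F (dhead d0) acc0) env)).
      apply: RunCons; first by apply: RunComp (RunHead _ _ _) (RunTail _ _ _).
      apply: RunCons; last by apply: RunComp (RunTail _ _ _) (RunTail _ _ _).
      apply: RunComp (IHp _); apply: RunCons; last exact: RunTail.
      exact: RunComp (RunHead _ _ _) (RunHead _ _ _).
    have stop acc0 : run leV rt (PWhile PHead body)
        (DCons DNil (DCons acc0 env)) (DCons DNil (DCons acc0 env)).
      by apply: RunWhileF; first exact: RunHead.
    elim: d acc => [|x|c _ d IHd] acc; first by exists DNil.
      exists DNil; apply: RunWhileT (stop _); first exact: RunHead.
        by [].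
      exact: step.
    have [d' hd] := IHd (F c acc); exists d'.
    by apply: RunWhileT hd; [exact: RunHead | | exact: step].
  have [d' hd] := loop (eval l env) (eval a env).
  apply: (RunComp (y := DCons d' (DCons (foldd F (eval l env) (eval a env)) env)));
    last exact: RunComp (RunTail _ _ _) (RunHead _ _ _).
  apply: (RunComp _ hd); apply: RunCons => //; apply: RunCons => //; exact: RunId.
- by move=> c a IHa env; apply: RunComp (IHa _) (RunInstr _ _ _ _).
Qed.

End Eval.

(** * The program *)

(** Variables are de Bruijn indices into the environment list; [tlet] and each fold body shift them,
    by one and by two. *)
Definition tvar (n : nat) : tm := THead (iter n TTail TEnv).
Definition tlet (e b : tm) : tm := TSub b (TCons e TEnv).
Definition tone : tm := TOp Defs.IOne TNil.
Definition tadd (a b : tm) : tm := TOp Defs.IAdd (TCons a b).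
Definition tmul (a b : tm) : tm := TOp Defs.IMul (TCons a b).
Definition topp (a : tm) : tm := TOp Defs.IOpp a.
Definition tinv (a : tm) : tm := TOp Defs.IInv a.
Definition tleV (a b : tm) : tm := TOp Defs.ILeV (TCons a b).
Definition tzero : tm := tadd tone (topp tone).
(** One root of X^2 + b X + c; for b = 0 this is a square root of - c. *)
Definition tmonic2 (c b : tm) : tm := TOp Defs.IRoot (TCons c (TCons b (TCons tone TNil))).
Definition trev (l : tm) : tm := TFold l TNil (TCons (tvar 0) (tvar 1)).
Definition tfoldr (l a p : tm) : tm := TFold (trev l) a p.
Definition thd (l : tm) : tm := TIf l (THead l) tzero.
Definition tdrop (n l : tm) : tm := TFold n l (TTail (tvar 1)).

Definition tsadd_step : tm :=
  TCons (TCons (tadd (tvar 0) (thd (TTail (tvar 1)))) (THead (tvar 1)))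
    (TTail (TTail (tvar 1))).

(** The first fold consumes a and stacks the sums in reverse next to the rest of b; the second moves
    them back onto that rest. *)
Definition tsadd (a b : tm) : tm :=
  TSub (tlet (TFold (tvar 0) (TCons TNil (tvar 1)) tsadd_step)
          (TFold (THead (tvar 0)) (TTail (tvar 0)) (TCons (tvar 0) (tvar 1))))
    (TCons a (TCons b TNil)).

Definition tsscale (c a : tm) : tm :=
  TSub (tfoldr (tvar 1) TNil (TCons (tmul (tvar 2) (tvar 0)) (tvar 1)))
    (TCons c (TCons a TNil)).

Definition tsopp (a : tm) : tm := tsscale (topp tone) a.

Definition tsmul (a b : tm) : tm :=
  TSub (tfoldr (tvar 0) TNil
          (tsadd (tsscale (tvar 0) (tvar 3)) (TCons tzero (tvar 1))))
    (TCons a (TCons b TNil)).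

Definition tdeflate (r a : tm) : tm :=
  THead (TSub (tfoldr (tvar 1) (TCons TNil tzero)
                 (TCons (TCons (TTail (tvar 1)) (THead (tvar 1)))
                    (tadd (tvar 0) (tmul (tvar 2) (TTail (tvar 1))))))
           (TCons r (TCons a TNil))).

(** The even and odd halves exchange roles with each coefficient prepended. *)
Definition teven (a : tm) : tm :=
  THead (tfoldr a (TCons TNil TNil)
           (TCons (TCons (tvar 0) (TTail (tvar 1))) (THead (tvar 1)))).

Definition tdilate (a : tm) : tm :=
  tfoldr a TNil (TCons (tvar 0) (TCons tzero (tvar 1))).

(* The state of the loop is (F . (a . b)). *)
Definition troot_step : tm :=
  let F := THead (tvar 3) in
  let a := THead (TTail (tvar 3)) in
  let b := TTail (TTail (tvar 3)) in
  TIf (TOp Defs.IRoot (THead (tvar 1)))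
    (tlet (TOp Defs.IRoot (THead (tvar 1)))
      (tlet (tmonic2 (tvar 0) tzero)
        (TCons (tdeflate (tvar 1) F)
          (TCons (tsadd (tsscale (tvar 0) a) (TCons tzero (tsopp b)))
            (tsadd (tsscale (tvar 0) b) a)))))
    (tvar 1).

Definition teven_sqrt (a : tm) : tm :=
  TSub
    (tlet (TFold TEnv (TCons TEnv (TCons (TCons tone TNil) TNil)) troot_step)
      (tlet (tmonic2 (topp (thd (THead (tvar 0)))) tzero)
        (tsadd (tdilate (tsscale (tvar 0) (THead (TTail (tvar 1)))))
           (TCons tzero (tdilate (tsscale (tvar 0) (TTail (TTail (tvar 1)))))))))
    (teven a).

(** Reading from the right, the counter restarts at 0 whenever the valuation is at most v(1) = 0, so
    the first such index remains. *)
Definition tunit_index (a : tm) : tm :=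
  tfoldr a TNil (TIf (tleV (tvar 0) tone) TNil (TCons TNil (tvar 1))).

(* Environment: e, A, g, h. *)
Definition tdigit : tm :=
  tlet (tsadd (tvar 2) (tsopp (tsmul (tvar 0) (tsadd (tvar 3) (tvar 0)))))
    (tlet
      (TIf (tdrop (tvar 2) (tvar 1))
        (tmul (thd (tdrop (tvar 2) (tdrop (tvar 1) (tvar 0))))
           (tinv (thd (tdrop (tvar 2) (tvar 4)))))
        (tmonic2 (topp (thd (tdrop (tvar 1) (tdrop (tvar 1) (tvar 0)))))
           (thd (tdrop (tvar 1) (tvar 4)))))
      (trev (TCons (tvar 0) (trev (tvar 2))))).

Definition tfour : tm := tadd (tadd tone tone) (tadd tone tone).

(* Environment: A, g, h, s, where g has not yet been divided by 4. *)
Definition tdigit_loop : tm :=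
  let body := TSub tdigit (TCons (tvar 1) (TCons (tvar 2)
    (TCons (tsscale (tinv tfour) (tvar 3)) (TCons (tvar 4) TNil)))) in
  TFold (tvar 2) (TFold (tvar 3) TNil body) body.

(** The bound 2 on valuations is tested by comparison with 4, as v(4) = 2. *)
Definition tsmall (a : tm) : tm :=
  TFold a (TCons TNil TNil) (TIf (tleV (tvar 0) tfour) TNil (tvar 1)).

(** Padding by n zeros turns x^(-n) s into x^(-2n) S, so that h can carry x^(-n) and the remainder
    x^(-2n). At the last [let] body the variables are, from 0 on: the result, the corrected
    remainder and h, e, A, g, h, S and the input. *)
Definition tmain : tm :=
  TSub
    (tlet (TFold (THead (tvar 0)) (TTail (tvar 0)) (TCons tzero (tvar 1)))
    (tlet (teven_sqrt (tvar 0))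
    (tlet (tsadd (tvar 1) (tsopp (tsmul (tvar 0) (tvar 0))))
    (tlet (tunit_index (tvar 1))
    (tlet tdigit_loop
    (tlet (tsadd (tvar 3) (tsadd (tvar 0) (tvar 0)))
    (tlet (tsadd (tvar 5) (tsopp (tsmul (tvar 0) (tvar 0))))
    (tlet (TIf (tsmall (tvar 0)) (TCons (tvar 1) (tvar 0)) (TCons (tvar 5) (tvar 4)))
    (let n := THead (tvar 8) in
     TCons (TCons n (THead (tvar 0)))
       (TCons (TFold n n (TCons TNil (tvar 1))) (TTail (tvar 0))))))))))))
    (TCons TEnv TNil).

(** * The algorithm on coefficient lists, and its agreement with the program *)

Section SeqFunctions.
Variables (K : fieldType) (leV : rel K) (rt : {poly K} -> K).
Implicit Types (s t : seq K) (d env : data K).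

Local Notation ev := (eval leV rt).

Fixpoint sadd s t : seq K :=
  if s is c :: s' then (c + head 0 t) :: sadd s' (behead t) else t.
Definition sscale (c : K) s : seq K := [seq c * x | x <- s].
Definition sopp s : seq K := sscale (-1) s.
Definition smul s t : seq K := foldr (fun c acc => sadd (sscale c t) (0 :: acc)) [::] s.
(** Horner's scheme: the second component is the value at r, and the earlier values form the
    quotient by X - r. *)
Definition horner_div (r : K) s : seq K * K :=
  foldr (fun c qw => (qw.2 :: qw.1, c + r * qw.2)) ([::], 0) s.
Definition sdeflate r s : seq K := (horner_div r s).1.
Definition seven s : seq K :=
  (foldr (fun c eo => (c :: eo.2, eo.1)) ([::], [::]) s).1.
Definition sdilate s : seq K := foldr (fun c acc => c :: 0 :: acc) [::] s.
Definition monic2 (c b : K) : {poly K} := Poly [:: c; b; 1].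

Definition dlist (s : seq (data K)) : data K := foldr (@DCons K) DNil s.

Lemma code_seqE s : code_seq s = dlist [seq DElt x | x <- s].
Proof. by elim: s => //= x s ->. Qed.

Lemma code_natE n : code_nat K n = dlist (nseq n DNil).
Proof. by elim: n => //= n ->. Qed.

Lemma foldd_dlist F (l : seq (data K)) acc :
  foldd F (dlist l) acc = foldl (fun acc c => F c acc) acc l.
Proof. by elim: l acc => //= c l IH acc; rewrite IH. Qed.

Lemma eval_rev l (s : seq (data K)) env :
  ev l env = dlist s -> ev (trev l) env = dlist (rev s).
Proof.
move=> /= ->; rewrite foldd_dlist /rev -[DNil]/(dlist [::]).
by elim: s [::] => //= c s IH acc; rewrite -IH.
Qed.

(** A simulation principle: if the body carries out one step on encoded states, the compiled fold
    carries out the whole [foldl]. *)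
Lemma eval_foldl T Y (f : T -> data K) (enc : Y -> data K) (g : Y -> T -> Y)
    l a p (s : seq T) y env :
  ev l env = dlist [seq f x | x <- s] -> ev a env = enc y ->
  (forall x z, ev p (DCons (f x) (DCons (enc z) env)) = enc (g z x)) ->
  ev (TFold l a p) env = enc (foldl g y s).
Proof.
move=> /= -> -> hp; rewrite foldd_dlist.
by elim: s y => //= x s IH y; rewrite hp IH.
Qed.

Lemma eval_foldr T Y (f : T -> data K) (enc : Y -> data K) (g : T -> Y -> Y)
    l a p (s : seq T) y env :
  ev l env = dlist [seq f x | x <- s] -> ev a env = enc y ->
  (forall x z, ev p (DCons (f x) (DCons (enc z) env)) = enc (g x z)) ->
  ev (tfoldr l a p) env = enc (foldr g y s).
Proof.
move=> /eval_rev hl ha hp.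
have -> : foldr g y s = foldl (fun z x => g x z) y (rev s) by rewrite foldl_rev.
by apply: (eval_foldl (f := f)) => //; rewrite map_rev.
Qed.

Lemma eval_zero env : ev tzero env = DElt 0.
Proof. by rewrite /= subrr. Qed.

Lemma eval_hd l s env : ev l env = code_seq s -> ev (thd l) env = DElt (head 0 s).
Proof. by rewrite /= => ->; case: s => [|c s] //=; rewrite subrr. Qed.

Lemma eval_opp a x env : ev a env = DElt x -> ev (topp a) env = DElt (- x).
Proof. by move=> /= ->. Qed.

Lemma eval_inv a x env : ev a env = DElt x -> ev (tinv a) env = DElt x^-1.
Proof. by move=> /= ->. Qed.

Lemma eval_mul a b x y env : ev a env = DElt x -> ev b env = DElt y ->
  ev (tmul a b) env = DElt (x * y).
Proof. by move=> /= -> ->. Qed.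

Lemma dtail_code s : dtail (code_seq s) = code_seq (behead s).
Proof. by case: s. Qed.

Lemma eval_drop n l (c : seq (data K)) s env :
  ev n env = dlist c -> ev l env = code_seq s ->
  ev (tdrop n l) env = code_seq (drop (size c) s).
Proof.
move=> hn hl; have -> : drop (size c) s = foldl (fun t _ => behead t) s c.
  by elim: c s {hn hl} => [|x c IH] s /=; rewrite ?drop0 // -IH; case: s.
by apply: (eval_foldl (f := id)) => //= [|x z]; rewrite ?map_id ?dtail_code.
Qed.

Lemma eval_sadd a b s t env : ev a env = code_seq s -> ev b env = code_seq t ->
  ev (tsadd a b) env = code_seq (sadd s t).
Proof.
move=> ha hb; pose st (x : seq K * seq K) := DCons (code_seq x.1) (code_seq x.2).
pose g (x : seq K * seq K) c := (c + head 0 x.2 :: x.1, behead x.2).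
(* The two folds of [tsadd] correspond to the reversed partial sums and to [catrev]. *)
have -> : sadd s t = catrev (foldl g ([::], t) s).1 (foldl g ([::], t) s).2.
  rewrite -[LHS]/(catrev [::] _); elim: s t [::] {ha hb} => //= c s IH t acc.
  by rewrite -IH.
set env1 := DCons (code_seq s) (DCons (code_seq t) DNil).
have e1 : ev (TFold (tvar 0) (TCons TNil (tvar 1)) tsadd_step) env1 =
    st (foldl g ([::], t) s).
  apply: (eval_foldl (f := @DElt K)); [exact: code_seqE | by [] |].
  move=> c [racc u] /=; rewrite dtail_code; congr (DCons (DCons _ _) _).
  by case: u => [|x u] //=; rewrite subrr.
have -> : ev (tsadd a b) env = ev (TFold (THead (tvar 0)) (TTail (tvar 0))
    (TCons (tvar 0) (tvar 1))) (DCons (st (foldl g ([::], t) s)) env1).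
  by rewrite -e1 /env1 -ha -hb.
move: (foldl _ _ _) => {e1} [x u].
transitivity (code_seq (foldl (fun l c => c :: l) u x)).
  by apply: (eval_foldl (f := @DElt K)); first exact: code_seqE.
by congr code_seq; elim: x u => //= c x IH u; rewrite IH.
Qed.

Lemma eval_sscale c a k s env : ev c env = DElt k -> ev a env = code_seq s ->
  ev (tsscale c a) env = code_seq (sscale k s).
Proof.
move=> hc ha; rewrite /tsscale; cbn [eval]; rewrite hc ha.
have -> : sscale k s = foldr (fun c acc => k * c :: acc) [::] s by elim: (s).
by apply: (eval_foldr (f := @DElt K)); first exact: code_seqE.
Qed.

Lemma eval_sopp a s env : ev a env = code_seq s -> ev (tsopp a) env = code_seq (sopp s).
Proof. by move=> ha; apply: eval_sscale. Qed.

Lemma eval_smul a b s t env : ev a env = code_seq s -> ev b env = code_seq t ->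
  ev (tsmul a b) env = code_seq (smul s t).
Proof.
move=> ha hb; rewrite /tsmul; cbn [eval]; rewrite ha hb.
apply: (eval_foldr (f := @DElt K)); [exact: code_seqE | by [] |] => c u.
by apply: eval_sadd; [apply: eval_sscale | rewrite /= subrr].
Qed.

Lemma eval_deflate r a k s env : ev r env = DElt k -> ev a env = code_seq s ->
  ev (tdeflate r a) env = code_seq (sdeflate k s).
Proof.
move=> hr ha; rewrite /tdeflate /sdeflate; cbn [eval]; rewrite hr ha.
rewrite (eval_foldr (f := @DElt K) (s := s) (y := ([::], 0))
  (enc := fun x : seq K * K => DCons (code_seq x.1) (DElt x.2))
  (g := fun c qw => (qw.2 :: qw.1, c + k * qw.2))) //; first exact: code_seqE.
by rewrite /= subrr.
Qed.

Lemma eval_even a s env : ev a env = code_seq s ->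
  ev (teven a) env = code_seq (seven s).
Proof.
move=> ha; rewrite /teven /seven; cbn [eval].
rewrite (eval_foldr (f := @DElt K) (s := s) (y := ([::], [::]))
  (enc := fun x : seq K * seq K => DCons (code_seq x.1) (code_seq x.2))
  (g := fun c eo => (c :: eo.2, eo.1))) //.
by rewrite ha; exact: code_seqE.
Qed.

Lemma eval_dilate a s env : ev a env = code_seq s ->
  ev (tdilate a) env = code_seq (sdilate s).
Proof.
move=> ha; apply: (eval_foldr (f := @DElt K)); [by rewrite ha; exact: code_seqE | by [] |].
by move=> c u /=; rewrite subrr.
Qed.

Lemma size_monic2 x y : size (monic2 x y) = 3%N.
Proof. by rewrite /monic2 (PolyK (c := 0)) //= oner_neq0. Qed.

Lemma eval_monic2 c b x y env : ev c env = DElt x -> ev b env = DElt y ->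
  ev (tmonic2 c b) env = DElt (rt (monic2 x y)).
Proof.
move=> hc hb; rewrite /tmonic2; cbn [eval]; rewrite hc hb.
by cbn [exec elts]; rewrite -[Poly _]/(monic2 x y) size_monic2.
Qed.

(* Splits off one root r of F: if z^2 = - r, then in a(x^2) + x b(x^2) the even
   part a^2 + y b^2 of the square (y = x^2) is multiplied by y - r when (a, b)
   is replaced by (z a - y b, z b + a). *)
Definition root_step (x : seq K * (seq K * seq K)) :=
  let: (F, (a, b)) := x in
  if (1 < size (Poly F))%N then
    let r := rt (Poly F) in
    let z := rt (monic2 r 0) in
    (sdeflate r F, (sadd (sscale z a) (0 :: sopp b), sadd (sscale z b) a))
  else x.

(** The list is used as a loop counter: its length bounds the number of roots, and further steps are
    idle. The start a = 1, b = 0 has a^2 + y b^2 = 1. *)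
Definition root_loop s := foldl (fun x (_ : K) => root_step x) (s, ([:: 1], [::])) s.

(** After the loop F is constant; its square root c is multiplied into a and b before forming a(x^2)
    + x b(x^2). *)
Definition even_sqrt s : seq K :=
  let x := root_loop (seven s) in
  let c := rt (monic2 (- head 0 x.1) 0) in
  sadd (sdilate (sscale c x.2.1)) (0 :: sdilate (sscale c x.2.2)).

Definition unit_index s : nat := find (leV^~ 1) s.

(* The next coefficient X of e, with r = g - h e - e^2 and i = size e.  Up to
   terms of positive valuation, adding X x^i to e changes coefficient 2i of r by
   - h_i X - X^2 (this is used for i <= A) and coefficient A + i by - h_A X. *)
Definition digit h g (A : nat) e : K :=
  let r := sadd g (sopp (smul e (sadd h e))) in
  let i := size e in
  if (A < i)%N then head 0 (drop A (drop i r)) * (head 0 (drop A h))^-1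
  else rt (monic2 (- head 0 (drop i (drop i r))) (head 0 (drop i h))).

(** Only the length of [N] matters: it counts the coefficients to be computed. *)
Definition digits h g A (N : seq K) e : seq K :=
  foldl (fun e _ => rcons e (digit h g A e)) e N.

Definition ssmall s : bool := all (fun c => ~~ leV c (1 + 1 + (1 + 1))) s.

Definition enc_decomposition (x : seq K * (seq K * seq K)) :=
  DCons (code_seq x.1) (DCons (code_seq x.2.1) (code_seq x.2.2)).

Lemma eval_root_step c x env :
  ev troot_step (DCons c (DCons (enc_decomposition x) env)) = enc_decomposition (root_step x).
Proof.
case: x => F [a b]; rewrite /troot_step /tlet; cbn zeta.
set envx := DCons c _.
have hF : ev (TOp Defs.IRoot (THead (tvar 1))) envx =
    if (1 < size (Poly F))%N then DElt (rt (Poly F)) else DNil.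
  suff E : elts (code_seq F) = F.
    by rewrite -[LHS]/(exec leV rt Defs.IRoot (code_seq F)) /exec E.
  by elim: (F) => //= y s ->.
cbn [eval]; cbn [eval] in hF; rewrite hF /root_step.
case: (1 < size (Poly F))%N => //.
cbn [is_dnil]; set r := rt _.
set env1 := DCons (DElt r) _.
rewrite (eval_monic2 (x := r) (y := 0)) //; last exact: eval_zero.
set z := rt (monic2 _ _); set env2 := DCons (DElt z) _.
rewrite /enc_decomposition; congr (DCons _ (DCons _ _)).
- exact: (@eval_deflate _ _ r).
- apply: eval_sadd; first exact: eval_sscale.
  by cbn [eval]; rewrite (@eval_sopp _ b) // -/(tzero) /= subrr.
- by apply: eval_sadd; first exact: eval_sscale.
Qed.

Lemma eval_even_sqrt a s env : ev a env = code_seq s ->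
  ev (teven_sqrt a) env = code_seq (even_sqrt s).
Proof.
move=> /eval_even ha; rewrite /teven_sqrt /tlet; cbn [eval]; rewrite ha.
set env1 := code_seq (seven s).
have -> : foldd (fun c acc => ev troot_step (DCons c (DCons acc env1))) env1
    (DCons env1 (DCons (DCons (exec leV rt Defs.IOne DNil) DNil) DNil))
    = enc_decomposition (root_loop (seven s)).
  have := @eval_foldl _ _ (@DElt K) enc_decomposition (fun x (_ : K) => root_step x)
    TEnv (TCons TEnv (TCons (TCons tone TNil) TNil)) troot_step (seven s)
    (seven s, ([:: 1], [::])) env1.
  apply=> //; first exact: code_seqE.
  by move=> x z; rewrite eval_root_step.
rewrite /even_sqrt; case: root_loop => F [u w].
set env2 := DCons (enc_decomposition _) env1.
rewrite (eval_monic2 (x := - head 0 F) (y := 0)); [ | | exact: eval_zero]; last first.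
  by apply: eval_opp; apply: eval_hd.
apply: eval_sadd; first by apply: eval_dilate; apply: eval_sscale.
set env3 := DCons (DElt _) _.
cbn [eval]; rewrite (@eval_dilate _ (sscale (rt (monic2 (- head 0 F) 0)) w)).
  by rewrite /= subrr.
exact: eval_sscale.
Qed.

Lemma eval_unit_index a s env : ev a env = code_seq s ->
  ev (tunit_index a) env = code_nat K (unit_index s).
Proof.
move=> ha; have -> : unit_index s = foldr (fun c n => if leV c 1 then 0%N else n.+1) 0%N s.
  by rewrite /unit_index; elim: (s) => //= c u ->.
apply: (eval_foldr (f := @DElt K)); [by rewrite ha; exact: code_seqE | by [] |].
by move=> c n /=; case: leV.
Qed.

Lemma eval_digit h g A e :
  ev tdigit (DCons (code_seq e) (DCons (code_nat K A) (DCons (code_seq g)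
    (DCons (code_seq h) DNil)))) = code_seq (rcons e (digit h g A e)).
Proof.
set env := DCons (code_seq e) _.
rewrite /tdigit /tlet; set r := sadd g (sopp (smul e (sadd h e))).
cbn [eval]; rewrite (@eval_sadd _ _ g (sopp (smul e (sadd h e)))) //; last first.
  by apply: eval_sopp; apply: eval_smul => //; apply: eval_sadd.
rewrite -/r; set env1 := DCons (code_seq r) env.
have hd n l c u : ev n env1 = dlist c -> ev l env1 = code_seq u ->
    ev (thd (tdrop n l)) env1 = DElt (head 0 (drop (size c) u)).
  by move=> hn hl; apply: eval_hd; apply: eval_drop.
have vA : ev (tvar 2) env1 = dlist (nseq A DNil) by rewrite -code_natE.
have ve : ev (tvar 1) env1 = dlist [seq DElt x | x <- e] by rewrite -code_seqE.
have -> : (if is_dnil (ev (tdrop (tvar 2) (tvar 1)) env1)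
    then ev (tmonic2 (topp (thd (tdrop (tvar 1) (tdrop (tvar 1) (tvar 0)))))
           (thd (tdrop (tvar 1) (tvar 4)))) env1
    else ev (tmul (thd (tdrop (tvar 2) (tdrop (tvar 1) (tvar 0))))
           (tinv (thd (tdrop (tvar 2) (tvar 4))))) env1)
    = DElt (digit h g A e).
  have -> : is_dnil (ev (tdrop (tvar 2) (tvar 1)) env1) = ~~ (A < size e)%N.
    rewrite (eval_drop (c := nseq A DNil) (s := e)) // size_nseq.
    have := size_drop A e; case: (drop A e) => [|x u] /= E; lia.
  rewrite /digit -/r; case: ltnP => _.
    apply: eval_mul.
      rewrite (@hd _ _ (nseq A DNil) (drop (size e) r)) // ?size_nseq //.
      by rewrite (eval_drop (c := [seq DElt x | x <- e]) (s := r)) ?size_map.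
    by apply: eval_inv; rewrite (@hd _ _ (nseq A DNil) h) // size_nseq.
  apply: eval_monic2.
    apply: eval_opp.
    rewrite (@hd _ _ [seq DElt x | x <- e] (drop (size e) r)) // ?size_map //.
    by rewrite (eval_drop (c := [seq DElt x | x <- e]) (s := r)) ?size_map.
  by rewrite (@hd _ _ [seq DElt x | x <- e] h) // size_map.
set env2 := DCons (DElt _) env1.
have h1 : ev (trev (tvar 2)) env2 = dlist (rev [seq DElt x | x <- e]).
  by apply: eval_rev; rewrite -code_seqE.
rewrite (@eval_rev _ (DElt (digit h g A e) :: rev [seq DElt x | x <- e])).
  by rewrite rev_cons revK code_seqE map_rcons.
by cbn [eval]; rewrite h1.
Qed.

Definition sresidue s h : seq K := sadd s (sopp (smul h h)).

(** Taking size S + size h coefficients of e reaches past the support of h and half that of the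
    remainder, as [approximates_end] requires. *)
Definition decompose (n : nat) s : seq K * seq K :=
  let S := nseq n 0 ++ s in
  let h := even_sqrt S in
  let g := sresidue S h in
  let e := let g4 := sscale (1 + 1 + (1 + 1))^-1 g in
    digits h g4 (unit_index h) h (digits h g4 (unit_index h) S [::]) in
  let h' := sadd h (sadd e e) in
  if ssmall (sresidue S h') then (h', sresidue S h') else (h, g).

Lemma eval_sresidue a b s h env : ev a env = code_seq s -> ev b env = code_seq h ->
  ev (tsadd a (tsopp (tsmul b b))) env = code_seq (sresidue s h).
Proof. by move=> ha hb; apply: eval_sadd => //; apply: eval_sopp; apply: eval_smul. Qed.

Lemma eval_digit_loop h g A S env :
  ev tdigit_loop (DCons (code_nat K A) (DCons (code_seq g) (DCons (code_seq h)
    (DCons (code_seq S) env)))) =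
  code_seq (digits h (sscale (1 + 1 + (1 + 1))^-1 g) A h
    (digits h (sscale (1 + 1 + (1 + 1))^-1 g) A S [::])).
Proof.
set env1 := DCons (code_nat K A) _; rewrite /tdigit_loop; cbn zeta.
set g4 := sscale _ _.
have step (x : K) e :
    ev (TSub tdigit (TCons (tvar 1) (TCons (tvar 2)
      (TCons (tsscale (tinv tfour) (tvar 3)) (TCons (tvar 4) TNil)))))
      (DCons (DElt x) (DCons (code_seq e) env1)) = code_seq (rcons e (digit h g4 A e)).
  by rewrite -eval_digit; cbn [eval]; rewrite (@eval_sscale _ _ (1 + 1 + (1 + 1))^-1 g).
apply: (eval_foldl (f := @DElt K) _ _ step); first exact: code_seqE.
by apply: (eval_foldl (f := @DElt K) _ _ step); first exact: code_seqE.
Qed.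

Lemma eval_small a s env : ev a env = code_seq s ->
  is_dnil (ev (tsmall a) env) = ~~ ssmall s.
Proof.
move=> ha; pose enc b : data K := if b then DCons DNil DNil else DNil.
have -> : ev (tsmall a) env = enc (ssmall s).
  have -> : ssmall s =
      foldl (fun b c => if leV c (1 + 1 + (1 + 1)) then false else b) true s.
    have E b : foldl (fun b c => if leV c (1 + 1 + (1 + 1)) then false else b) b s
        = b && ssmall s.
      elim: s b {ha} => [|c s IH] b /=; first by rewrite andbT.
      by rewrite IH; case: leV; rewrite //= ?andbF.
    by rewrite E.
  apply: (eval_foldl (f := @DElt K)); [by rewrite ha; exact: code_seqE | by [] |].
  by move=> c b /=; case: leV.
by rewrite /enc; case: ssmall.
Qed.

Lemma foldd_nat F n (acc : data K) : foldd F (code_nat K n) acc = iter n (F DNil) acc.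
Proof. by elim: n acc => // n IH acc; rewrite iterSr -IH. Qed.

Lemma eval_sub a b env x y : ev a env = x -> ev b x = y -> ev (TSub b a) env = y.
Proof. by move=> <-. Qed.

Lemma eval_if c a b env (t : bool) : is_dnil (ev c env) = ~~ t ->
  ev (TIf c a b) env = if t then ev a env else ev b env.
Proof. by move=> /= ->; case: t. Qed.

Lemma eval_let e b env x y : ev e env = x -> ev b (DCons x env) = y ->
  ev (tlet e b) env = y.
Proof. by move=> <-. Qed.

Lemma eval_main n s :
  ev tmain (DCons (code_nat K n) (code_seq s)) =
  DCons (DCons (code_nat K n) (code_seq (decompose n s).1))
        (DCons (code_nat K (n + n)) (code_seq (decompose n s).2)).
Proof.
set d := DCons _ _; rewrite /decompose; set S := nseq n 0 ++ s.
have hS : ev (TFold (THead (tvar 0)) (TTail (tvar 0)) (TCons tzero (tvar 1))) (DCons d DNil)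
    = code_seq S.
  etransitivity; first exact: (foldd_nat _ n (code_seq s)).
  by rewrite /S; elim: (n) => //= m ->; rewrite /= subrr.
rewrite /tmain; apply: (eval_sub (x := DCons d DNil)) => //.
apply: (eval_let hS).
apply: eval_let; first exact: (eval_even_sqrt (s := S)).
set h := even_sqrt S; apply: eval_let; first exact: (eval_sresidue (s := S) (h := h)).
set g := sresidue S h; apply: eval_let; first exact: (eval_unit_index (s := h)).
apply: eval_let; first exact: eval_digit_loop.
set e := digits _ _ _ _ _; apply: eval_let.
  by apply: (eval_sadd (s := h)) => //; apply: (eval_sadd (s := e) (t := e)).
set h' := sadd h _; apply: eval_let; first exact: (eval_sresidue (s := S) (h := h')).
set g' := sresidue S h'.
set x := if ssmall g' then (h', g') else (h, g).
apply: (eval_let (x := DCons (code_seq x.1) (code_seq x.2))).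
  set env := DCons (code_seq g') _.
  rewrite (eval_if _ _ (eval_small (a := tvar 0) (s := g') (env := env) erefl)).
  by rewrite /x; case: ssmall.
set env := DCons _ (DCons _ _).
have hn : ev (TFold (THead (tvar 8)) (THead (tvar 8)) (TCons TNil (tvar 1))) env
    = code_nat K (n + n).
  etransitivity; first exact: (foldd_nat _ n (code_nat K n)).
  by rewrite /code_nat iterD.
by rewrite -hn.
Qed.

Lemma run_main n s : run leV rt (compile tmain) (DCons (code_nat K n) (code_seq s))
  (DCons (DCons (code_nat K n) (code_seq (decompose n s).1))
         (DCons (code_nat K (n + n)) (code_seq (decompose n s).2))).
Proof. by rewrite -eval_main; exact: run_compile. Qed.

End SeqFunctions.

(** * Correctness *)

Section LaurentOfPoly.
Variable K : fieldType.
Implicit Types (p q : {poly K}) (n m : nat).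

(** The Laurent polynomial x^(-n) p(x). *)
Definition laurent_of_poly n p : laurent K :=
  [fsfun i in [fset (j%:Z - n%:Z)%R | j in iota 0 (size p)]%fset =>
     if i + n%:Z is Posz j then p`_j else 0].

Lemma laurent_of_polyE n p (i : int) :
  laurent_of_poly n p i = if i + n%:Z is Posz j then p`_j else 0.
Proof.
rewrite fsfunE; case: ifPn => // ni; case E: (i + n%:Z) => [j|//].
rewrite nth_default // leqNgt; apply: contra ni => js.
by apply/imfsetP; exists j; rewrite ?mem_iota //= -E addrK.
Qed.

Lemma laurent_of_poly_nat n p (j : nat) : laurent_of_poly n p (j%:Z - n%:Z) = p`_j.
Proof. by rewrite laurent_of_polyE subrK. Qed.

Lemma laurent_of_poly_low n p (i : int) : i < - n%:Z -> laurent_of_poly n p i = 0.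
Proof. by move=> h; rewrite laurent_of_polyE; case E: (i + n%:Z) => [j|//]; lia. Qed.

Lemma laurent_of_poly_cases n (i : int) :
  i < - n%:Z \/ exists j : nat, i = j%:Z - n%:Z.
Proof.
case E: (i + n%:Z) => [j|j]; last by left; lia.
by right; exists j; rewrite -E addrK.
Qed.

Lemma laurent_of_polyP n p (f : laurent K) :
  (forall i, i < - n%:Z -> f i = 0) -> (forall j : nat, f (j%:Z - n%:Z) = p`_j) ->
  f = laurent_of_poly n p.
Proof.
move=> flow fE; apply/fsfunP => i.
have [h|[j ->]] := laurent_of_poly_cases n i; last by rewrite fE laurent_of_poly_nat.
by rewrite flow // laurent_of_poly_low.
Qed.

Lemma laurent_of_polyD n p q :
  laurent_of_poly n (p + q) = laurent_of_poly n p + laurent_of_poly n q.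
Proof.
symmetry; apply: laurent_of_polyP => [i h|j]; rewrite coefD.
  by rewrite !laurent_of_poly_low ?addr0.
by rewrite !laurent_of_poly_nat -poly.coefD.
Qed.

Lemma laurent_of_polyN n p : laurent_of_poly n (- p) = - laurent_of_poly n p.
Proof.
symmetry; apply: laurent_of_polyP => [i h|j]; rewrite coefN.
  by rewrite !laurent_of_poly_low ?oppr0.
by rewrite !laurent_of_poly_nat -poly.coefN.
Qed.

Lemma laurent_of_polyM n m p q :
  laurent_of_poly n p * laurent_of_poly m q = laurent_of_poly (n + m) (p * q).
Proof.
have E (k : int) : (laurent_of_poly n p * laurent_of_poly m q) k =
    \sum_(j < size p) p`_j * laurent_of_poly m q (k - (j%:Z - n%:Z)).
  pose D := [fset (j%:Z - n%:Z)%R | j in iota 0 (size p)]%fset.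
  rewrite [LHS](lmulEw (D := D)).
    rewrite big_imfset /=; last by move=> i j _ _ /addIr[].
    rewrite undup_id ?iota_uniq // -{1}[size p]subn0 big_mkord.
    by apply: eq_bigr => j _; rewrite laurent_of_poly_nat.
  apply/fsubsetP => i; rewrite mem_finsupp.
  have [h|[j ->]] := laurent_of_poly_cases n i.
    by rewrite laurent_of_poly_low ?eqxx.
  rewrite laurent_of_poly_nat => pj; apply/imfsetP; exists j => //=.
  by rewrite mem_iota /= add0n ltnNge; apply: contra pj => /(nth_default 0) ->.
apply: laurent_of_polyP => [k h|k]; rewrite E.
  by rewrite big1 // => j _; rewrite laurent_of_poly_low ?mulr0 //; lia.
rewrite -[p in RHS]coefK poly_def mulr_suml coef_sum; apply: eq_bigr => j _.
rewrite -scalerAl coefZ coefXnM; congr (_ * _); case: ltnP => h.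
  by rewrite laurent_of_poly_low //; lia.
by rewrite -(laurent_of_poly_nat m); congr (laurent_of_poly m q _); lia.
Qed.

Lemma codes_laurent_of_poly (f : laurent K) d : codes f d <->
  exists n s, d = DCons (code_nat K n) (code_seq s) /\ f = laurent_of_poly n (Poly s).
Proof.
split=> -[n [s [-> fE]]]; exists n, s; split=> //.
  by apply/fsfunP => i; rewrite fE laurent_of_polyE; case: (i + _) => // j; rewrite coef_Poly.
by move=> i; rewrite fE laurent_of_polyE; case: (i + _) => // j; rewrite coef_Poly.
Qed.

End LaurentOfPoly.

(** * Polynomial arithmetic on lists and the square root of the even part *)

Section PolyOfSeq.
Variables (K : fieldType) (leV : rel K) (rt : {poly K} -> K).
Implicit Types (s t : seq K).

Lemma head_drop s n : head 0 (drop n s) = s`_n.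
Proof. by rewrite -nth0 nth_drop addn0. Qed.

Lemma Poly_sadd s t : Poly (sadd s t) = Poly s + Poly t.
Proof.
elim: s t => [|c s IH] t /=; first by rewrite add0r.
rewrite !cons_poly_def IH; case: t => [|d t] /=.
  by rewrite !addr0.
by rewrite cons_poly_def polyCD; ring.
Qed.

Lemma Poly_sscale c s : Poly (sscale c s) = c%:P * Poly s.
Proof.
elim: s => [|x s IH] /=; first by rewrite mulr0.
by rewrite !cons_poly_def IH polyCM; ring.
Qed.

Lemma Poly_sopp s : Poly (sopp s) = - Poly s.
Proof. by rewrite Poly_sscale polyCN mulN1r. Qed.

Lemma Poly_smul s t : Poly (smul s t) = Poly s * Poly t.
Proof.
elim: s => [|c s IH] /=; first by rewrite mul0r.
by rewrite Poly_sadd Poly_sscale /= !cons_poly_def IH polyC0; ring.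
Qed.

Lemma Poly_sdilate s : Poly (sdilate s) = Poly s \Po 'X^2.
Proof.
elim: s => [|c s IH] /=; first by rewrite comp_poly0.
by rewrite !cons_poly_def IH comp_poly_MXaddC polyC0; ring.
Qed.

Lemma Poly_sresidue s h : Poly (sresidue s h) = Poly s - Poly h ^+ 2.
Proof. by rewrite Poly_sadd Poly_sopp Poly_smul. Qed.

Lemma nth_seven s k : (seven s)`_k = s`_(k + k).
Proof.
(* The induction has to carry the odd half along, since the halves alternate. *)
suff [] : (seven s)`_k = s`_(k + k) /\
    (foldr (fun c eo => (c :: eo.2, eo.1)) ([::], [::]) s).2`_k = s`_(k + k).+1 by [].
rewrite /seven; elim: s k => [|c s IH] k /=; first by rewrite !nth_nil.
split; last by case: (IH k).
by case: k => //= k; case: (IH k) => _ ->; rewrite addnS.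
Qed.

Lemma Poly_horner_div r s : Poly s =
  Poly (horner_div r s).1 * ('X - r%:P) + (horner_div r s).2%:P.
Proof.
elim: s => [|c s IH] /=; first by rewrite mul0r add0r polyC0.
by rewrite !cons_poly_def {1}IH polyCD polyCM; ring.
Qed.

Lemma Poly_sdeflate r s : root (Poly s) r -> Poly s = Poly (sdeflate r s) * ('X - r%:P).
Proof.
rewrite /root => /eqP; rewrite {1}(Poly_horner_div r s) !hornerE subrr mulr0 add0r => w0.
by rewrite {1}(Poly_horner_div r s) w0 polyC0 addr0.
Qed.

Hypothesis rtP : root_oracle rt.

Lemma monic2_root c b : let z := rt (monic2 c b) in z ^+ 2 + b * z + c = 0.
Proof.
move=> z; have : root (monic2 c b) z by apply: rtP; rewrite size_monic2.
rewrite /root /monic2 => /eqP <-; rewrite /= !cons_poly_def !hornerE; ring.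
Qed.

(** The invariant of the root loop. The form a^2 + y b^2 is the norm of a + b sqrt(-y), hence
    multiplicative, and F is the factor not yet absorbed. *)
Definition twisted_norm (x : seq K * (seq K * seq K)) : {poly K} :=
  Poly x.1 * (Poly x.2.1 ^+ 2 + 'X * Poly x.2.2 ^+ 2).

(** With z^2 = - r, (z a - y b)^2 + y (z b + a)^2 = (y - r)(a^2 + y b^2), which compensates the
    division of F by y - r. Each step lowers the degree until F is constant. *)
Lemma root_stepP x : twisted_norm (root_step rt x) = twisted_norm x /\
  (size (Poly (root_step rt x).1) <= maxn 1 (size (Poly x.1)).-1)%N.
Proof.
case: x => F [a b]; rewrite /root_step; case: ltnP => /= hF; last first.
  by split=> //; rewrite leq_max hF.
set r := rt _; have rF : root (Poly F) r by exact: rtP.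
have EF := Poly_sdeflate rF.
set z := rt _; have := monic2_root r 0; rewrite -/z /= => hz.
split.
  rewrite /twisted_norm /= [in RHS]EF !Poly_sadd !Poly_sscale /= cons_poly_def Poly_sopp.
  have -> : r%:P = - (z%:P ^+ 2) :> {poly K}.
    by rewrite -polyC_exp -polyCN; congr polyC; move: hz; rewrite mul0r addr0 => /eqP; rewrite addrC addr_eq0 => /eqP.
  by rewrite polyC0; ring.
have q0 : Poly (sdeflate r F) != 0.
  by apply: contraTneq hF => q0; rewrite EF q0 mul0r size_poly0.
by rewrite EF size_Mmonic ?monicXsubC // size_XsubC addn2 /= leq_maxr.
Qed.

Lemma root_loopP s : twisted_norm (root_loop rt s) = Poly s /\
  (size (Poly (root_loop rt s).1) <= 1)%N.
Proof.
rewrite /root_loop; set x0 := (s, _).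
have loop t x : twisted_norm (foldl (fun x (_ : K) => root_step rt x) x t) = twisted_norm x /\
    (size (Poly (foldl (fun x (_ : K) => root_step rt x) x t).1)
      <= maxn 1 (size (Poly x.1) - size t))%N.
  elim: t x => [|c t IH] x /=; first by rewrite subn0 leq_maxr.
  have [IH1 IH2] := IH (root_step rt x); have [h1 h2] := root_stepP x.
  rewrite IH1 h1; split=> //; apply: leq_trans IH2 _.
  by move: h2; move: (size _) (size (Poly x.1)) => m n; lia.
have [h1 h2] := loop s x0; split.
  rewrite h1 /twisted_norm /= !cons_poly_def; ring.
apply: leq_trans h2 _; have /eqP -> // : (size (Poly x0.1) - size s == 0)%N.
by rewrite subn_eq0 size_Poly.
Qed.

(** The square of c a(x^2) + x c b(x^2) has even part c^2 (a^2 + y b^2) at y = x^2; the cross term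
    is x times a polynomial in x^2. *)
Lemma even_sqrtP s k : (Poly (even_sqrt rt s) ^+ 2)`_(k + k) = s`_(k + k).
Proof.
have [hN hF] := root_loopP (seven s); rewrite /even_sqrt.
case: root_loop hN hF => F [a b] /=; rewrite /twisted_norm /= => hN hF.
set c := rt _; have := monic2_root (- head 0 F) 0; rewrite -/c /= => hc.
have FE : Poly F = (c ^+ 2)%:P.
  rewrite (size1_polyC hF) coef_Poly nth0; congr polyC; symmetry; apply/eqP.
  by rewrite -subr_eq0; move: hc; rewrite mul0r addr0 => ->.
have -> : Poly (sadd (sdilate (sscale c a)) (0 :: sdilate (sscale c b))) ^+ 2 =
    (Poly (seven s) \Po 'X^2) + 'X * (((c ^+ 2)%:P * (Poly a * Poly b) *+ 2) \Po 'X^2).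
  rewrite -hN FE Poly_sadd /= cons_poly_def !Poly_sdilate !Poly_sscale polyC0 polyC_exp.
  rewrite !mulr2n !(comp_polyD, comp_polyM, rmorphXn) /= !comp_polyX !comp_polyC; ring.
rewrite poly.coefD coefXM; set u := (_ *+ 2).
(* For k = 0 the predecessor 2k - 1 is truncated to 0, but multiplication by X already makes that
   coefficient zero. *)
have odd0 : (u \Po 'X^2)`_(k + k).-1 = 0 \/ (k + k = 0)%N.
  case: k => [|k]; [by right | left]; rewrite addSn addnS /= .
  by rewrite coef_comp_poly_Xn // dvdn2 /= addnn odd_double.
rewrite coef_comp_poly_Xn // dvdn2 addnn odd_double /= -muln2 mulnK // coef_Poly.
rewrite muln2 -addnn nth_seven; case: odd0 => [->|->]; rewrite ?eqxx ?addr0 //.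
by case: ifP; rewrite addr0.
Qed.

End PolyOfSeq.

(** * Correctness of the computed coefficients of e *)

Section Digits.
Variables (K : fieldType) (v : K -> \bar rat) (rt : {poly K} -> K).
Hypotheses (hv : is_valuation v) (v2 : v 2%:R = 1%:E) (rtP : root_oracle rt).
Implicit Types (s h g e : seq K) (n : nat).

Local Notation O x := (Order.le (0%R)%:E (v x)).
Local Notation M x := (Order.lt (0%R)%:E (v x)).

Definition val_le (a b : K) : bool := (v a <= v b)%E.

Lemma unit_indexP h : (exists j, ~ M h`_j) ->
  ~ M h`_(unit_index val_le h) /\ forall j, (j < unit_index val_le h)%N -> M h`_j.
Proof.
have E x : val_le x 1 = ~~ (M x) by rewrite /val_le (val1 hv) leNgt.
move=> [j hj]; split.
  have : has (val_le^~ 1) h.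
    apply/(has_nthP 0); exists j; last by rewrite E; apply/negP.
    by rewrite ltnNge; apply/negP => hs; apply: hj; rewrite nth_default // (val0 hv).
  by move=> /(nth_find 0); rewrite E => /negP.
by move=> k /(before_find 0); rewrite E => /negbFE.
Qed.

Lemma residual_laurent n h g e :
  residual (laurent_of_poly (n + n) (Poly g)) (laurent_of_poly n (Poly h))
    (laurent_of_poly n (Poly e))
  = laurent_of_poly (n + n) (Poly (sadd g (sopp (smul e (sadd h e))))).
Proof.
rewrite /residual expr2 !laurent_of_polyM -!laurent_of_polyN -!laurent_of_polyD.
by congr laurent_of_poly; rewrite Poly_sadd Poly_sopp Poly_smul Poly_sadd; ring.
Qed.

Lemma digit_approximates n h g e (A : nat) :
  let hL := laurent_of_poly n (Poly h) in
  let gL := laurent_of_poly (n + n) (Poly g) in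
  (forall j : nat, O h`_j) -> ~ M h`_A -> (forall j, (j < A)%N -> M h`_j) ->
  approximates v gL hL ((size e)%:Z - n%:Z) (laurent_of_poly n (Poly e)) ->
  approximates v gL hL ((size (rcons e (digit rt h g A e)))%:Z - n%:Z)
    (laurent_of_poly n (Poly (rcons e (digit rt h g A e)))).
Proof.
move=> hL gL hO hA hlow app; set X := digit rt h g A e.
have hLE j : hL (j%:Z - n%:Z) = h`_j by rewrite laurent_of_poly_nat coef_Poly.
have hLO l : O (hL l).
  have [low|[j ->]] := laurent_of_poly_cases n l; last by rewrite hLE.
  by rewrite [hL l]laurent_of_poly_low // (val0 hv).
set r := sadd g (sopp (smul e (sadd h e))).
(* List positions j and k stand for exponents j - n and k - n, whose sum matches the shift by 2n of
   the residual. *)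
have rE j k : residual gL hL (laurent_of_poly n (Poly e))
    (j%:Z - n%:Z + (k%:Z - n%:Z)) = r`_(j + k).
  rewrite residual_laurent -/r.
  have -> : j%:Z - n%:Z + (k%:Z - n%:Z) = (j + k)%N%:Z - (n + n)%N%:Z by lia.
  by rewrite laurent_of_poly_nat coef_Poly.
have -> : (size (rcons e X))%:Z - n%:Z = (size e)%:Z - n%:Z + 1.
  by rewrite size_rcons; lia.
apply: (approximates_step hv v2 (a := A%:Z - n%:Z) (X := X) hLO _ _ app).
- by rewrite hLE.
- move=> l lA; have [low|[j lj]] := laurent_of_poly_cases n l.
    by rewrite [hL l]laurent_of_poly_low // (val0 hv).
  by rewrite lj hLE; apply: hlow; lia.
- move=> iA; rewrite rE hLE /X /digit -/r.
  have -> : (A < size e)%N = false by move: iA; rewrite lerD2r lez_nat leqNgt => /negbTE.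
  rewrite !head_drop nth_drop; apply/eqP; rewrite -subr_eq0.
  by have /= -> := monic2_root rtP (- r`_(size e + size e)) h`_(size e).
- move=> Ai; rewrite rE hLE /X /digit -/r.
  have -> : (A < size e)%N by move: Ai; rewrite ltrD2r ltz_nat.
  rewrite !head_drop nth_drop addnC divfK //.
  by apply: contra_notN hA => /eqP ->; rewrite (val0 hv).
- move=> l; have [low|[j ->]] := laurent_of_poly_cases n l.
    rewrite !laurent_of_poly_low //; case: eqP => // lE; lia.
  rewrite !laurent_of_poly_nat !coef_Poly nth_rcons (inj_eq (addIr _)) eqz_nat.
  by case: ltngtP => // js; rewrite nth_default // ltnW.
Qed.

Lemma digits_approximates n h g (A : nat) N e :
  let hL := laurent_of_poly n (Poly h) in
  let gL := laurent_of_poly (n + n) (Poly g) in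
  (forall j : nat, O h`_j) -> ~ M h`_A -> (forall j, (j < A)%N -> M h`_j) ->
  approximates v gL hL ((size e)%:Z - n%:Z) (laurent_of_poly n (Poly e)) ->
  approximates v gL hL ((size e + size N)%N%:Z - n%:Z)
    (laurent_of_poly n (Poly (digits rt h g A N e))).
Proof.
move=> hL gL hO hA hlow; elim: N e => [|c N IH] e app; first by rewrite addn0.
rewrite addnS -addSn -(size_rcons e (digit rt h g A e)).
by apply: IH; apply: digit_approximates.
Qed.

Lemma size_digits h g A N e : size (digits rt h g A N e) = (size e + size N)%N.
Proof.
by elim: N e => [|c N IH] e /=; rewrite ?addn0 // IH size_rcons addSnnS.
Qed.

Lemma ssmallP s : reflect (forall j, (2%:E < v s`_j)%E) (ssmall val_le s).
Proof.
have E x : val_le x (1 + 1 + (1 + 1)) = (v x <= 2%:E)%E.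
  rewrite /val_le; have -> : 1 + 1 + (1 + 1) = 1 *+ 4 :> K by ring.
  by rewrite (val_mul4 hv v2) (val1 hv) adde0.
apply: (iffP (all_nthP 0)) => hs j.
  have [/hs|js] := ltnP j (size s); first by rewrite E ltNge.
  by rewrite nth_default // (val0 hv) ltry.
by move=> _; rewrite E -ltNge.
Qed.

End Digits.

(** * The Gauss valuation as an attained minimum *)

Section GaussValuation.
Variables (RR : realType) (K : fieldType) (v : K -> \bar rat).
Hypothesis hv : is_valuation v.
Implicit Types f g h : laurent K.

Lemma er_map_ratr_le (x y : \bar rat) :
  (er_map (@ratr RR) x <= er_map (@ratr RR) y)%E = (x <= y)%E.
Proof. by case: x y => [x||] [y||] //=; rewrite ?lee_fin ?ler_rat ?leey ?leNye. Qed.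

Lemma er_map_ratr_lt (x y : \bar rat) :
  (er_map (@ratr RR) x < er_map (@ratr RR) y)%E = (x < y)%E.
Proof. by rewrite !ltNge er_map_ratr_le. Qed.

Lemma gauss_valE f j : (forall l, v (f j) <= v (f l))%E ->
  gauss_val RR v f = er_map ratr (v (f j)).
Proof.
move=> hj; apply/eqP; rewrite eq_le; apply/andP; split.
  by apply: ereal_inf_lbound; exists j.
by apply: le_ereal_inf_tmp => _ [l _ <-]; rewrite er_map_ratr_le.
Qed.

(** Finite support makes the real infimum a minimum, so that comparisons of Gauss valuations reduce
    to rational ones. *)
Lemma gauss_val_attained f : exists j, forall l, (v (f j) <= v (f l))%E.
Proof.
have [->|/(gauss_index hv)[j [_ hj _]]] := eqVneq f 0; last by exists j.
by exists 0 => l; rewrite ![lzero _ _]lzeroE.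
Qed.

Lemma gauss_val_gt2 f : (2%:E < gauss_val RR v f)%E <-> forall l, (2%:E < v (f l))%E.
Proof.
have -> : 2%:E = er_map (@ratr RR) 2%:E :> \bar RR by rewrite /= ratr_nat.
have [j hj] := gauss_val_attained f; rewrite (gauss_valE hj) er_map_ratr_lt.
by split=> [h l|]; [apply: lt_le_trans h (hj l) | apply].
Qed.

End GaussValuation.

(** * Optimality of the computed decomposition *)

Section Optimality.
Variables (RR : realType) (K : fieldType) (v : K -> \bar rat) (rt : {poly K} -> K).
Variable (R : set K).
Hypotheses (hv : is_valuation v) (v2 : v 2%:R = 1%:E) (rtP : root_oracle rt).
Hypothesis (RE : forall x, R x <-> (0 <= v x)%E).

Local Notation O x := (Order.le (0%R)%:E (v x)).
Local Notation M x := (Order.lt (0%R)%:E (v x)).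

Lemma laurent_of_poly_pad n (s : seq K) :
  laurent_of_poly n (Poly s) = laurent_of_poly (n + n) (Poly (nseq n 0 ++ s)).
Proof.
apply: laurent_of_polyP => [i h|j]; first by rewrite laurent_of_poly_low //; lia.
rewrite coef_Poly nth_cat size_nseq nth_nseq; case: ltnP => h.
  by rewrite laurent_of_poly_low //; lia.
have -> : j%:Z - (n + n)%N%:Z = (j - n)%N%:Z - n%:Z by lia.
by rewrite laurent_of_poly_nat coef_Poly.
Qed.

Lemma laurent_of_sresidue n (s h : seq K) :
  laurent_of_poly (n + n) (Poly (sresidue s h)) =
  laurent_of_poly (n + n) (Poly s) - laurent_of_poly n (Poly h) ^+ 2.
Proof.
by rewrite Poly_sresidue laurent_of_polyD laurent_of_polyN [in RHS]expr2 laurent_of_polyM -expr2.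
Qed.

Lemma decompose_optimal n s (f : laurent K) :
  f = laurent_of_poly n (Poly s) -> laurent_over R f -> gauss_val RR v f = 0%:E ->
  optimal_decomposition RR R v f
    (laurent_of_poly n (Poly (decompose (val_le v) rt n s).1))
    (laurent_of_poly (n + n) (Poly (decompose (val_le v) rt n s).2)).
Proof.
set S := nseq n 0 ++ s; move=> fE fR f0.
have fO l : O (f l) by apply/RE.
have {}fE : f = laurent_of_poly (n + n) (Poly S) by rewrite fE laurent_of_poly_pad.
pose LH (h : seq K) := laurent_of_poly n (Poly h).
pose LG (g : seq K) := laurent_of_poly (n + n) (Poly g).
have resE h : LG (sresidue S h) = f - LH h ^+ 2 by rewrite /LG laurent_of_sresidue fE.
(* For both candidates integrality needs checking only on even coefficients of the remainder: they
   determine those of h^2, hence h is integral by [integral_of_sqr_even]. *)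
have good h : (forall k : int, O (LG (sresidue S h) (k + k))) ->
    (2%:E < gauss_val RR v (LG (sresidue S h)) \/
     gauss_val RR v (LG (sresidue S h)) = sq_val RR R v f)%E ->
    optimal_decomposition RR R v f (LH h) (LG (sresidue S h)).
  move=> evO opt.
  have hO l : O (LH h l).
    apply: (integral_of_sqr_even hv) => k.
    have -> : LH h ^+ 2 = f - LG (sresidue S h) by rewrite resE; ring.
    by rewrite coefB; apply: val_geB.
  split.
  - by move=> i; apply/RE.
  - move=> i; apply/RE; rewrite resE coefB; apply: val_geB => //.
    by rewrite expr2; apply: integral_coefM.
  - by rewrite resE; ring.
  - by case: opt; [right | left].
rewrite /decompose -/S; set h := even_sqrt rt S; set g := sresidue S h.
set g4 := sscale _ g; set A := unit_index _ h.
set e := digits _ _ _ _ _ _; set h' := sadd h (sadd e e).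
have gev (k : int) : LG g (k + k) = 0.
  have [low|[j kj]] := laurent_of_poly_cases n k.
    by rewrite [LHS]laurent_of_poly_low //; lia.
  have -> : k + k = (j + j)%N%:Z - (n + n)%N%:Z by lia.
  rewrite [LHS]laurent_of_poly_nat Poly_sresidue poly.coefB coef_Poly.
  by rewrite (even_sqrtP rtP) subrr.
have [small|nsmall] := boolP (ssmall _ _).
  have big l : (2%:E < v (LG (sresidue S h') l))%E.
    have [low|[j ->]] := laurent_of_poly_cases (n + n) l.
      by rewrite [LG _ l]laurent_of_poly_low // (val0 hv) ltry.
    by rewrite [LG _ _]laurent_of_poly_nat coef_Poly; move/(ssmallP hv v2): small.
  apply: good; last by left; apply/gauss_val_gt2.
  by move=> k; apply: le_trans (ltW (big _)); rewrite lee_fin.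
apply: good; first by move=> k; rewrite gev (val0 hv).
have [i0 gmin] := gauss_val_attained hv (LG g); have gE := gauss_valE RR gmin.
have [g2|g2] := ltP 2%:E (v (LG g i0)).
  by left; apply/gauss_val_gt2 => // l; apply: lt_le_trans (gmin l).
have hO l : O (LH h l).
  apply: (integral_of_sqr_even hv) => k.
  have -> : LH h ^+ 2 = f - LG g by rewrite resE; ring.
  by rewrite coefB gev subr0.
right; apply/eqP; rewrite eq_le; apply/andP; split.
  apply: ereal_sup_ubound; exists (LH h); last by rewrite -resE.
  by move=> i; apply/RE.
(* A strictly better k provides, through [improvement], a solution modulo the maximal ideal. The
   computed e is then also one, and the failed smallness test is contradicted. *)
apply: ge_ereal_sup => _ [k kR <-]; rewrite leNgt; apply/negP => better.
have {}better l : (v (LG g i0) < v ((f - k ^+ 2)%R l))%E.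
  rewrite -(er_map_ratr_lt RR) -gE; apply: lt_le_trans better _.
  by apply: ereal_inf_lbound; exists l.
have kO l : O (k l) by apply/RE; apply: kR.
have n4 : 1 + 1 + (1 + 1) != 0 :> K.
  apply/eqP => E4; have := val_mul4 hv v2 1.
  by rewrite (_ : 1 *+ 4 = 0) ?(val0 hv) ?(val1 hv) // -E4; ring.
have gE4 : LG g = LG g4 *+ 4.
  rewrite /LG; have -> : Poly g = Poly g4 *+ 4.
    rewrite Poly_sscale -mulr_natl mulrA.
    have -> : 4%:R * (1 + 1 + (1 + 1))^-1%:P = 1 :> {poly K}.
      have -> : 4%:R = (1 + 1 + (1 + 1))%:P :> {poly K} by rewrite !polyCD polyC1; ring.
      by rewrite -polyCM divff.
    by rewrite mul1r.
  by rewrite !mulrS mulr0n !addr0 !laurent_of_polyD.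
have fE' : f = LH h ^+ 2 + LG g by rewrite resE; ring.
have [gi0 [E [EO Esmall]]] :=
  improvement hv v2 hO kO fE' gev gE4 gmin g2 better.
(* If all coefficients of h were small, f = h^2 + g would have positive valuation, as v(g) = 2; but
   v(f) = 0. *)
have hunit : exists j, ~ M h`_j.
  apply: contrapT => nh.
  have hM l : M (LH h l).
    have [low|[j ->]] := laurent_of_poly_cases n l.
      by rewrite [LH _ l]laurent_of_poly_low // (val0 hv).
    rewrite [LH _ _]laurent_of_poly_nat coef_Poly.
    by apply: contrapT => hj; apply: nh; exists j.
  have [j fmin] := gauss_val_attained hv f.
  have : (0%:E < v (f j))%E.
    rewrite fE' coefD; apply: val_gtD => //; last first.
      by apply: lt_le_trans (gmin j); rewrite gi0 lte_fin.
    by rewrite expr2; apply: small_coefMl.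
  rewrite -(er_map_ratr_lt RR) -(gauss_valE RR fmin) f0 /= rmorph0.
  by rewrite ltxx.
have [hA hlow] := unit_indexP hv hunit; rewrite -/A in hA hlow.
have hjO j : O h`_j by have := hO (j%:Z - n%:Z); rewrite [LH _ _]laurent_of_poly_nat coef_Poly.
have start : approximates v (LG g4) (LH h) (0%N%:Z - n%:Z)
    (laurent_of_poly n (Poly [::])).
  have -> : laurent_of_poly n (Poly [::]) = 0 :> laurent K.
    apply/fsfunP => l; rewrite [RHS]lzeroE laurent_of_polyE.
    by case: (l + _) => // m; rewrite coef0.
  apply: (approximates_start hv hO EO) => // [l low|l low].
    by rewrite [LH _ _]laurent_of_poly_low //; lia.
  by rewrite [LG _ _]laurent_of_poly_low //; lia.
have app1 := digits_approximates hv v2 rtP S hjO hA hlow start.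
rewrite -(size_digits rt h g4 A S [::]) in app1.
have app2 := digits_approximates hv v2 rtP h hjO hA hlow app1.
rewrite -/e size_digits in app2.
set hi := (_ + size h)%N in app2.
have hiS : (size S <= hi)%N by rewrite /hi -addnA addnC -addnA leq_addr.
have hih : (size h <= hi)%N by rewrite /hi leq_addl.
move: hi hiS hih app2 => hi hiS hih app2.
have rsmall l : M (residual (LG g4) (LH h) (LH e) l).
  apply: (approximates_end hv v2 hO _ _ app2) => {}l lhi.
    have [low|[j lj]] := laurent_of_poly_cases n l.
      by rewrite [LHS]laurent_of_poly_low.
    rewrite lj [LHS]laurent_of_poly_nat coef_Poly nth_default //.
    by apply: leq_trans hih _; lia.
  have [low|[j lj]] := laurent_of_poly_cases (n + n) l.
    by rewrite [LHS]laurent_of_poly_low.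
  have jhi : (hi + hi <= j)%N by lia.
  rewrite lj [LHS]laurent_of_poly_nat Poly_sscale coefCM Poly_sresidue poly.coefB.
  rewrite coef_Poly [S`__]nth_default; last by apply: leq_trans jhi; exact: leq_trans hiS (leq_addr _ _).
  rewrite [(Poly h ^+ 2)`_j]nth_default ?subrr ?mulr0 //.
  have := size_polyMleq (Poly h) (Poly h); rewrite -expr2 => /leq_trans -> //.
  have := leq_trans (size_Poly h) hih; move: jhi; move: (size _) => m; lia.
case/negP: nsmall; apply/(ssmallP hv v2) => j.
(* The identity f - (h + 2e)^2 = 4 (g/4 - h e - e^2) turns positive valuation of the residual into
   valuation above 2. *)
have -> : (sresidue S h')`_j = (residual (LG g4) (LH h) (LH e) *+ 4) (j%:Z - (n + n)%N%:Z).
  have -> : residual (LG g4) (LH h) (LH e) *+ 4 = LG (sresidue S h').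
    have -> : LG (sresidue S h') = LG g - (LH e *+ 4 * LH h + LH e ^+ 2 *+ 4).
      rewrite !resE /h' /LH !Poly_sadd !laurent_of_polyD -/(LH h) -/(LH e); ring.
    by rewrite gE4 /residual; ring.
  by rewrite [RHS]laurent_of_poly_nat coef_Poly.
rewrite (mulrnA _ 2 2) !coef_mul2 !(val_mul2 hv v2) addeA.
have := rsmall (j%:Z - (n + n)%N%:Z); case: (v _) => [x||] //.
by rewrite -!EFinD !lte_fin; clear - hv v2 rtP RE; move=> ?; lra.
Qed.

End Optimality.

(** This lets the pure existence statement follow from the effective one. *)
Lemma root_oracle_exists (K : closedFieldType) : exists rt : {poly K} -> K, root_oracle rt.
Proof.
suff /choice[rt rtP] : forall p : {poly K}, exists x, (1 < size p)%N -> root p x.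
  by exists rt.
move=> p; case: (ltnP 1 (size p)) => [p1|_]; last by exists 0.
by have /closed_rootP[x px] : size p != 1%N; [rewrite gtn_eqF | exists x].
Qed.

Lemma codes_exists (K : fieldType) (f : laurent K) : exists d, codes f d.
Proof.
(* The sum of the absolute values of all exponents is a crude bound for each, so positions 0 to 2n
   cover the support. *)
pose n := (\sum_(i <- finsupp f) `|i|)%N.
have supp (i : int) : i \in finsupp f -> (`|i| <= n)%N.
  by move=> fi; rewrite /n (bigD1_seq i) ?fset_uniq //= leq_addr.
pose s := mkseq (fun j => f (j%:Z - n%:Z)) (n + n).+1.
exists (DCons (code_nat K n) (code_seq s)).
apply/codes_laurent_of_poly; exists n, s; split=> //.
apply: laurent_of_polyP => [i low|j].
  by apply: coef_out; apply/negP => /supp; lia.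
rewrite coef_Poly; have [js|js] := ltnP j (n + n).+1; first by rewrite nth_mkseq.
rewrite [RHS]nth_default ?size_mkseq //.
by apply: coef_out; apply/negP => /supp; lia.
Qed.

Theorem proposition3p2p6 :
  exists P : prog,
  forall (RR : realType)
    (R1 : idomainType) (k1 : fieldType) (red : {rmorphism R1 -> k1})
    (K : closedFieldType) (iota : {rmorphism {fraction R1} -> K})
    (v : K -> \bar rat),
    complete_dvr R1 ->
    [pchar {fraction R1}] =i pred0 ->
    (forall y : k1, exists x : R1, red x = y) ->
    2%N \in [pchar k1] ->
    (forall x : K, algebraicOver iota x) ->
    is_valuation v ->
    (forall x : K, integral_closure iota x <-> (0 <= v x)%E) ->
    v 2%:R = 1%:E ->
    forall f : laurent K,
      laurent_over (integral_closure iota) f ->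
      gauss_val RR v f = 0%:E ->
      (exists h g : laurent K,
         optimal_decomposition RR (integral_closure iota) v f h g) /\
      (forall rt : {poly K} -> K, root_oracle rt ->
       forall d : data K, codes f d ->
       exists (h g : laurent K) (dh dg : data K),
         [/\ run (fun a b => (v a <= v b)%E) rt P d (DCons dh dg),
             codes h dh, codes g dg
           & optimal_decomposition RR (integral_closure iota) v f h g]).
Proof.
exists (compile tmain) => RR R1 k1 red K iota v _ _ _ _ _ hv integralE v2 f fR f0.
have effective (rt : {poly K} -> K) : root_oracle rt -> forall d, codes f d ->
    exists (h g : laurent K) (dh dg : data K),
      [/\ run (fun a b => (v a <= v b)%E) rt (compile tmain) d (DCons dh dg),
          codes h dh, codes g dg
        & optimal_decomposition RR (integral_closure iota) v f h g].
  move=> rtP d /codes_laurent_of_poly[n [s [-> fE]]].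
  have opt := decompose_optimal hv v2 rtP integralE fE fR f0.
  move: opt (run_main (val_le v) rt n s); move: (decompose _ _ _ _) => [h g] opt hrun.
  exists (laurent_of_poly n (Poly h)), (laurent_of_poly (n + n) (Poly g)).
  exists (DCons (code_nat K n) (code_seq h)), (DCons (code_nat K (n + n)) (code_seq g)).
  split; [exact: hrun | | | exact: opt].
  - by apply/codes_laurent_of_poly; exists n, h.
  - by apply/codes_laurent_of_poly; exists (n + n)%N, g.
(* Existence follows by running the program with some root oracle on some code of f. *)
split=> //; have [rt rtP] := root_oracle_exists K; have [d fd] := codes_exists f.
by have [h [g [_ [_ [_ _ _ opt]]]]] := effective rt rtP d fd; exists h, g.
Qed.
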